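(* Let $0<a\le2$ and let $\alpha:\mathbb{R}\to\mathbb{R}$ be Lebesgue measurable with $a\le\alpha(x)\le2$ for all $x\in\mathbb{R}$. There exists a stochastic process $\{I(f):f\in\mathcal{F}_\alpha\}$, indexed by the function space $\mathcal{F}_\alpha$, whose finite-dimensional distributions are given by $$\mathbb{E}\Big(\exp i\sum_{j=1}^d\theta_jI(f_j)\Big)=\exp\Big\{-\int\Big|\sum_{j=1}^d\theta_jf_j(x)\Big|^{\alpha(x)}dx\Big\}$$ for all $d\in\mathbb{N}$, all $f_1,\dots,f_d\in\mathcal{F}_\alpha$ and all $(\theta_1,\dots,\theta_d)\in\mathbb{R}^d$.
   Context: Integrals without limits are over $\mathbb{R}$ with respect to Lebesgue measure. For a measurable $\alpha:\mathbb{R}\to[a,b]$ with $0<a\le b<\infty$, $\mathcal{F}_\alpha$ is the variable exponent Lebesgue space of measurable functions $f:\mathbb{R}\to\mathbb{R}$ with $\|f\|_\alpha<\infty$, where $\|f\|_\alpha$ is the number $\lambda>0$ for which $\int|f(x)/\lambda|^{\alpha(x)}dx=1$ (and $\|f\|_\alpha=0$ if $f=0$ a.e.). Equivalently, $f\in\mathcal{F}_\alpha$ iff $\int|f(x)|^{\alpha(x)}dx<\infty$. *)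

(* Defs.v *)
From HB Require Import structures.
From mathcomp Require Import all_boot all_order all_algebra.
From mathcomp Require Import complex.
From mathcomp Require Import all_classical all_reals all_analysis.

Set Implicit Arguments.
Unset Strict Implicit.
Unset Printing Implicit Defensive.

Import Order.TTheory GRing.Theory Num.Theory.

Local Open Scope classical_set_scope.
Local Open Scope ring_scope.

(* The real line with the sigma-algebra of Lebesgue measurable sets, given as
   the Caratheodory sigma-algebra, i.e. the domain of
   [completed_lebesgue_measure]. The default structure on [R] carries only the
   Borel sets. *)
Notation lebesgueR R :=
  (caratheodory_type
     (mu_ext (@wlength R idfun : set (ocitv_type R) -> \bar R))).

Section variable_exponent_space.
Context {R : realType}.
Implicit Types alpha f : lebesgueR R -> R.

Definition modular alpha f : \bar R :=
  (\int[@completed_lebesgue_measure R]_x (`|f x| `^ alpha x)%:E)%E.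

(* For alpha > 0 and f measurable and not a.e. null, the set below has at most
   one element, so that its infimum is that element, or +oo if there is none. *)
Definition vnorm alpha f : \bar R :=
  if `[< {ae @completed_lebesgue_measure R, forall x, f x = 0} >] then 0%E
  else ereal_inf
    (EFin @` [set l | 0 < l /\ modular alpha (fun x => f x / l) = 1%E]).

Definition Fspace alpha : set (lebesgueR R -> R) :=
  [set f | measurable_fun setT f /\ (vnorm alpha f < +oo)%E].

End variable_exponent_space.

Section complex_expectation.
Context {R : realType}.

Definition cexp (z : R[i]) : R[i] :=
  (expR (complex.Re z) * cos (complex.Im z)
   +i* (expR (complex.Re z) * sin (complex.Im z)))%C.

(* Meant for integrable Z; [fine] sends infinite values to 0. *)
Definition cexpectation d (Omega : measurableType d) (P : probability Omega R)
    (Z : Omega -> R[i]) : R[i] :=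
  (fine 'E_P[fun w => complex.Re (Z w)]
   +i* fine 'E_P[fun w => complex.Im (Z w)])%C.

End complex_expectation.

(* Main.v *)
Require Import Defs.
From HB Require Import structures.
From mathcomp Require Import all_boot all_order all_algebra.
From mathcomp Require Import complex.
From mathcomp Require Import all_classical all_reals all_analysis.
From mathcomp Require Import measurable_realfun.
From mathcomp Require Import ring lra zify.

Set Implicit Arguments.
Unset Strict Implicit.
Unset Printing Implicit Defensive.

Import Order.TTheory GRing.Theory Num.Theory.
Import numFieldNormedType.Exports.

Local Open Scope classical_set_scope.
Local Open Scope ring_scope.

(** The functional [f |-> \int |f|^alpha] is assembled, by countable sums, from
    exponents of explicit processes that are linear in [f]. Call a functional
    [psi] realizable when some family of random variables [I f] satisfies
    [E exp (i \sum_j theta_j I f_j) = exp (- psi (\sum_j theta_j f_j))]. As the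
    exponent of a sum of independent processes is the sum of their exponents,
    realizable functionals can be added, and [realizable_sum] shows that
    convergent series of nonnegative realizable functionals are realizable.

    Where [alpha = 2], the functional [\int f^2] is by the Parseval identity for
    the Haar system a series of squares of linear forms [l f]; such a square is
    the exponent of the Gaussian variable [sqrt 2 * l f * G]
    ([realizable_gauss], [energy_cvg], [realizable_white_noise]).

    Where [alpha < 2], a change of variable gives, for a finite constant [k_b],
    [\int_0^oo (1 - exp (- y^2 w^(- 2/b))) dw = k_b |y|^b]. So, with [p] the
    standard normal density and [c (x) = k_(alpha x) p x],
    [\int |f|^alpha = \int_0^oo \int (1 - exp (- (f x)^2 r (x, w)^2)) p x dx dw]
    for [r (x, w) = (c x * w)^(- 1/alpha x)]. Cut the range of [w] into the
    intervals [[j, j + 1]]. On each of them [x] and [w] follow probability laws,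
    normal and uniform, and [exp (- (f x)^2 r^2)] is the characteristic function
    of [sqrt 2 * f x * r * G] with [G] standard Gaussian; the contribution is
    thus [1 - phi_j f], with [phi_j f] the characteristic function of
    [sqrt 2 * f X * r (X, j + W) * G], and this is the exponent of a compound
    Poisson process of rate 1 ([realizable_poisson], [mixture_exponent],
    [jump_exponent], [realizable_below2]).

    The probability space is the space of infinite sequences of fair coins.
    Reading the tosses of even and of odd rank separately gives two independent
    fair sequences ([fair_unzip]), and repeating this provides all the
    independent copies that the sums require; the quantile transform provides
    the normal, uniform and Poisson variables ([fair_sample]).

    A series of independent processes is handled as follows. Its partial sums
    [S n f] have characteristic functions that are explicit in [psi_ k], and
    averaging [E cos (t (S m f - S n f))] over a standard normal [t] controls
    [E (1 - exp (- (S m f - S n f)^2 / 2))]. This makes the partial sums Cauchy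
    in probability, and Borel-Cantelli yields an almost sure limit [I f] along a
    subsequence. The subsequence depends on [f], so the joint law of several
    [I f_j] is recovered from the bound
    [|cos a - cos b| <= 2 |sin ((a - b) / 2)|] and the subadditivity of [|sin|],
    which reduce it to the characteristic functions of each [I f_j - S n f_j].

    The functions of the theorem are Lebesgue measurable, the construction is
    about Borel functions. [borel_version] and [modular_borel] relate them:
    a linear combination of Borel versions is a version of the linear
    combination, and the integrals agree. *)

(** * Binary digits of a uniform number *)

(** The events requiring heads at finitely many places. They are stable under
    intersection, so a measure on [coins] is determined by its values on them,
    and they contain the empty requirement, that is, the whole space. *)
Definition cylinder (s : seq nat) : set (nat -> bool) :=
  [set w | all (fun i => w i) s].

Notation coins := (g_sigma_algebraType (range cylinder)).

Lemma setI_closed_cylinder : setI_closed (range cylinder).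
Proof.
move=> _ _ [s _ <-] [t _ <-]; exists (s ++ t) => //.
by apply/seteqP; split=> [w|w [sw tw]]; rewrite /cylinder /= all_cat;
  [move/andP|exact/andP].
Qed.

Lemma measurable_cylinder s : measurable (cylinder s : set coins).
Proof. by apply: sub_sigma_algebra; exists s. Qed.

Lemma measurable_toss i : measurable_fun setT (fun w : coins => w i).
Proof.
apply: (measurable_fun_bool true); rewrite setTI.
have -> : (fun w : coins => w i) @^-1` [set true] = cylinder [:: i].
  by apply/seteqP; split=> w; rewrite /cylinder /= ?andbT.
exact: measurable_cylinder.
Qed.

Lemma measurable_to_coins d (T : measurableType d) (f : T -> coins) :
  (forall i, measurable_fun setT (fun x => f x i)) -> measurable_fun setT f.
Proof.
move=> mf; apply: (@measurability _ _ T coins setT f (range cylinder)) => //.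
move=> _ [_ [s _ <-] <-]; rewrite setTI; elim: s => [|i s IH] /=.
  by rewrite [X in measurable X](_ : _ = setT)//; apply/seteqP; split.
have -> : f @^-1` cylinder (i :: s) =
    (fun x => f x i) @^-1` [set true] `&` f @^-1` cylinder s.
  by apply/seteqP; split => x; rewrite /cylinder /=; [move/andP|move=> ?; exact/andP].
by apply: measurableI => //; rewrite -[X in measurable X]setTI; exact: mf.
Qed.

Lemma measurable_truncn (R : realType) : measurable_fun setT (@Num.truncn R).
Proof.
move=> _ A _; rewrite setTI.
have -> : @Num.truncn R @^-1` A =
    (fun x : R => (Num.truncn x)%:R : R) @^-1` ((fun n => n%:R) @` A).
  apply/seteqP; split=> x /= => [Ax|[n An /eqP]]; first by exists (Num.truncn x).
  by rewrite eqr_nat => /eqP <-.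
have mt : measurable_fun setT (fun x : R => (Num.truncn x)%:R : R).
  by apply: nondecreasing_measurable => // x y xy; rewrite ler_nat; exact: le_truncn.
rewrite -[X in measurable X]setTI; apply: mt => //.
apply: countable_measurable; last first.
  by apply: sub_countable (countableP A); apply: card_image_le.
by move=> *; exact: measurable_set1.
Qed.

Section binary_digits.
Variable R : realType.

Definition digits (x : R) : coins := fun i => odd (Num.truncn (2 ^+ i.+1 * x)).

Lemma measurable_digits : measurable_fun setT digits.
Proof.
apply: measurable_to_coins => i.
apply: (@measurableT_comp _ _ _ _ _ _ (odd : nat -> bool)) => //.
apply: measurableT_comp; first exact: measurable_truncn.
exact: mulrl_measurable.
Qed.

Definition dyadic n k : set R := `[k%:R / 2 ^+ n, k.+1%:R / 2 ^+ n[%classic.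

Lemma lebesgue_dyadic n k : lebesgue_measure (dyadic n k) = (2^-n)%:E.
Proof.
rewrite /dyadic lebesgue_measure_itv /= lte_fin ltr_pM2r ?invr_gt0 ?exprn_gt0//.
by rewrite ltr_nat ltnSn -EFinB -mulrBl -natr1 addrAC subrr add0r mul1r.
Qed.

(** On the nonnegative half line, membership in a dyadic interval is a value of
    a truncation; this turns the geometry of dyadic intervals into arithmetic on
    digits. *)
Lemma dyadicE n k x : 0 <= x -> dyadic n k x <-> Num.truncn (2 ^+ n * x) = k.
Proof.
move=> x0; rewrite /dyadic /= in_itv /= ler_pdivrMr ?ltr_pdivlMr ?exprn_gt0//.
rewrite ![x * _]mulrC -truncn_eq; last by rewrite mulr_ge0// exprn_ge0.
by split => /eqP.
Qed.

Lemma dyadic_ge0 n k x : dyadic n k x -> 0 <= x.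
Proof.
rewrite /dyadic /= in_itv /= => /andP[+ _]; apply: le_trans.
by rewrite divr_ge0// exprn_ge0.
Qed.

Lemma truncn_double (y : R) : 0 <= y -> (Num.truncn (2 * y))./2 = Num.truncn y.
Proof.
move=> y0; apply/eqP; rewrite eq_sym truncn_eq//.
have := @truncn_itv R (2 * y); rewrite mulr_ge0// => /(_ isT).
set m := Num.truncn _; have := odd_double_half m; set k := m./2 => mk.
rewrite -mk -muln2 => /andP[h1 h2]; apply/andP; split.
  rewrite -(@ler_pM2l _ 2)//; apply: le_trans h1.
  by rewrite -natrM ler_nat mulnC leq_addl.
rewrite -(@ltr_pM2l _ 2)//; apply: (lt_le_trans h2).
by rewrite -natrM ler_nat; case: odd; lia.
Qed.

(** Fixing one more binary digit selects a half of a dyadic interval, since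
    halving [truncn (2 ^+ n.+1 * x)] drops its last binary digit. *)
Lemma dyadic_split n k (b : bool) :
  dyadic n k `&` [set x | digits x n = b] = dyadic n.+1 (b + k.*2).
Proof.
apply/seteqP; split=> x.
  move=> [kx /= bx]; have x0 := dyadic_ge0 kx; apply/dyadicE => //.
  move/dyadicE : kx => /(_ x0) <-.
  rewrite -(@truncn_double (2 ^+ n * x)) ?mulr_ge0 ?exprn_ge0// mulrA -exprS -[b]bx /digits.
  by rewrite odd_double_half.
move=> kx; have x0 := dyadic_ge0 kx; move/dyadicE : kx => /(_ x0) kx.
split; last by rewrite /= /digits kx oddD odd_double addbF; case: b {kx}.
apply/dyadicE => //.
by rewrite -(@truncn_double (2 ^+ n * x)) ?mulr_ge0 ?exprn_ge0// mulrA -exprS kx half_bit_double.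
Qed.

(** Only the places where [m] is true are constrained, as in a cylinder. *)
Definition pattern n (m : seq bool) : set R :=
  [set x | forall i, nth false m i -> digits x (n + i)%N].

Lemma measurable_digit i b : measurable [set x | digits x i = b].
Proof.
have := measurableT_comp (measurable_toss i) measurable_digits.
by move=> /(_ measurableT [set b] I); rewrite setTI.
Qed.

Lemma measurable_pattern n m : measurable (pattern n m).
Proof.
have -> : pattern n m = \bigcap_(i in [set i | nth false m i])
    [set x | digits x (n + i)%N = true] by [].
by apply: bigcap_measurableType => i _; exact: measurable_digit.
Qed.

Lemma pattern_cons n b m :
  pattern n (b :: m) =
  (if b then [set x | digits x n = true] else setT) `&` pattern n.+1 m.
Proof.
apply/seteqP; split=> x.
  move=> h; split; first by case: b h => // /(_ 0%N isT); rewrite addn0.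
  by move=> i mi; have := h i.+1 mi; rewrite addnS addSn.
case=> bx h [/= b1|i mi]; first by rewrite addn0; move: bx; rewrite b1.
by have := h i mi; rewrite addnS addSn.
Qed.

(** Induction on the pattern: a constrained digit halves the interval, and for an
    unconstrained one the two halves add up. *)
Lemma lebesgue_pattern n k m :
  lebesgue_measure (dyadic n k `&` pattern n m) = (2^-(n + count id m))%:E.
Proof.
elim: m n k => [|b m IH] n k.
  rewrite [pattern _ _](_ : _ = setT); last first.
    by apply/seteqP; split => // x _ i; rewrite nth_nil.
  by rewrite setIT addn0 lebesgue_dyadic.
have H c : lebesgue_measure
    (dyadic n k `&` [set x | digits x n = c] `&` pattern n.+1 m) =
    (2 ^- (n.+1 + count id m))%:E by rewrite dyadic_split IH.
rewrite pattern_cons setIA /=; case: b; first by rewrite H addSnnS.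
have -> : dyadic n k `&` setT `&` pattern n.+1 m =
  (dyadic n k `&` [set x | digits x n = true] `&` pattern n.+1 m) `|`
  (dyadic n k `&` [set x | digits x n = false] `&` pattern n.+1 m).
  apply/seteqP; split=> x; last by move=> [] [[? ?] ?].
  by move=> [[kx _] mx]; case bx : (digits x n); [left|right].
have md c : measurable (dyadic n k `&` [set x | digits x n = c] `&` pattern n.+1 m).
  by rewrite dyadic_split; apply: measurableI; [exact: measurable_itv
    |exact: measurable_pattern].
apply: etrans.
  apply: measureU; [exact: md|exact: md|].
  by apply/seteqP; split => // x [[[_ /= ->] _]] [[_ /=]].
transitivity ((2 ^- (n.+1 + count id m))%:E + (2 ^- (n.+1 + count id m))%:E : \bar R)%E.
  by congr (_ + _)%E; exact: H.
by rewrite -EFinD addSn exprS invfM; congr EFin; lra.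
Qed.

End binary_digits.

(** * The space of fair coin tosses *)

Section mfun_of.
Context d d' (T : measurableType d) (T' : measurableType d') (f : T -> T').
Hypothesis mf : measurable_fun setT f.

Definition mfun_of : {mfun T >-> T'} :=
  HB.pack_for {mfun T >-> T'} f (isMeasurableFun.Build _ _ _ _ f mf).

End mfun_of.

Section fair_measure.
Variable R : realType.

Lemma uniform_probE (A : set R) : measurable A ->
  uniform_prob (@ltr01 R) A = lebesgue_measure (A `&` `[0, 1]%classic).
Proof.
move=> mA; rewrite /uniform_prob integral_uniform_pdf.
rewrite (eq_integral (cst 1%E)) ?integral_cst ?mul1e//; first exact: measurableI.
move=> x; rewrite inE /= in_itv /= => -[_ x01].
by rewrite /uniform_pdf x01 subr0 invr1.
Qed.

(** Fair coin tossing, obtained without an infinite product of measures as the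
    law of the binary digits of a uniform number. *)
Definition fair : set coins -> \bar R :=
  distribution (uniform_prob (@ltr01 R))
    (@mfun_of _ _ (measurableTypeR R) coins _ (@measurable_digits R)).

HB.instance Definition _ := Probability.on fair.

(** A cylinder is a pattern of digits; [undup] appears because a place may be
    listed twice in [s]. *)
Lemma fair_cylinder s : fair (cylinder s) = (2 ^- size (undup s))%:E.
Proof.
pose m := mkseq (fun i => i \in s) (\max_(i <- s) i).+1.
have bnd i : i \in s -> (i <= \max_(i <- s) i)%N.
  by move=> iS; apply: (@leq_bigmax_seq _ s xpredT (fun i => i)).
have ms i : nth false m i = (i \in s).
  have [iN|iN] := ltnP i (\max_(i <- s) i).+1; first by rewrite nth_mkseq.
  rewrite nth_default ?size_mkseq//; apply/esym; apply/negbTE; apply/negP => iS.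
  by move: iN; rewrite ltnNge bnd.
have cm : count id m = size (undup s).
  rewrite /m count_map -size_filter; apply/perm_size/uniq_perm.
  - by rewrite filter_uniq// iota_uniq.
  - exact: undup_uniq.
  - move=> i; rewrite mem_filter mem_undup mem_iota add0n ltnS.
    by apply/andP/idP => [[]//|iS]; split => //; exact: bnd.
rewrite /fair /distribution /pushforward /=.
rewrite uniform_probE; last first.
  rewrite -[X in measurable X]setTI; apply: measurable_digits => //.
  exact: measurable_cylinder.
rewrite -cm -[in RHS](add0n (count id m)) -(@lebesgue_pattern R 0 0 m).
rewrite (_ : `[0, 1]%classic = @dyadic R 0 0 `|` [set 1]); last first.
  apply/seteqP; split => x /=; rewrite /dyadic /= !in_itv /= expr0 divr1 divr1.
    by move=> /andP[-> ]; rewrite le_eqVlt => /orP[/eqP ->|->]; [right|left].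
  by move=> [/andP[-> /ltW]//|->]; rewrite ler01 lexx.
have -> : digits (R:=R) @^-1` cylinder s = @pattern R 0 m.
  apply/seteqP; split => x; rewrite /cylinder /pattern /=.
    by move=> /allP h i; rewrite ms => /h.
  by move=> h; apply/allP => i iS; apply: (h i); rewrite ms.
rewrite setIC setIUl; apply: measureU0.
- by apply: measurableI; [exact: measurable_itv|exact: measurable_pattern].
- by apply: measurableI; [exact: measurable_set1|exact: measurable_pattern].
- apply/eqP; rewrite eq_le measure_ge0 andbT.
  rewrite -(lebesgue_measure_set1 (1:R)); apply: le_measure; rewrite ?inE.
  + by apply: measurableI; [exact: measurable_set1|exact: measurable_pattern].
  + exact: measurable_set1.
  + exact: subIsetl.
Qed.

(** The factor [c] allows for measures of the form [A |-> fair (A & B)], through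
    which independence is extended one argument at a time in [fair_unzip]. *)
Lemma fair_unique (m : {measure set coins -> \bar R}) c : 0 <= c ->
  (forall s, m (cylinder s) = c%:E * fair (cylinder s))%E ->
  forall A, measurable A -> m A = (c%:E * fair A)%E.
Proof.
move=> c0 ms A mA; have -> : (c%:E * fair A = mscale (NngNum c0) fair A)%E by [].
apply: (@measure_unique _ R coins (range cylinder) (fun=> setT)) => //.
- exact: setI_closed_cylinder.
- by move=> _; exists [::] => //; apply/seteqP; split.
- by rewrite bigcup_const//; exists 0%N.
- by move=> _ [s _ <-]; exact: ms.
- move=> _; have := ms [::]; rewrite [cylinder _](_ : _ = setT)//.
    by move=> ->; rewrite probability_setT mule1 ltry.
  by apply/seteqP; split.
Qed.

Definition unzip (w : coins) : coins * coins :=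
  (fun i => w i.*2, fun i => w i.*2.+1).

Lemma measurable_unzip : measurable_fun setT unzip.
Proof.
apply: measurable_fun_pair; apply: measurable_to_coins => i;
  exact: measurable_toss.
Qed.

(** The two halves of the tosses are independent and both fair: for cylinders
    this is a count of distinct even and odd places, and uniqueness of measures
    extends it, first in the second argument and then in the first one. *)
Lemma fair_unzip A B : measurable A -> measurable B ->
  fair (unzip @^-1` (A `*` B)) = (fair A * fair B)%E.
Proof.
have mcut1 : measurable_fun setT (fun w => (unzip w).1 : coins).
  by apply: measurable_to_coins => i; exact: measurable_toss.
have mcut2 : measurable_fun setT (fun w => (unzip w).2 : coins).
  by apply: measurable_to_coins => i; exact: measurable_toss.
have fairc s t : fair (unzip @^-1` (cylinder s `*` cylinder t)) =
    (fair (cylinder s) * fair (cylinder t))%E.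
  have -> : unzip @^-1` (cylinder s `*` cylinder t) =
      cylinder ([seq i.*2 | i <- s] ++ [seq i.*2.+1 | i <- t]).
    apply/seteqP; split => w; rewrite /cylinder /= all_cat !all_map.
      by move=> [? ?]; exact/andP.
    by move/andP.
  rewrite !fair_cylinder -EFinM -invfM -exprD; congr (_ ^- _)%:E.
  rewrite undup_cat size_cat -(size_map double) -[in RHS](size_map (S \o double)).
  congr (_ + _)%N; last first.
    rewrite undup_map_inj ?size_map// => i j /= [] /eqP.
    by rewrite -!muln2 eqn_pmul2r// => /eqP.
  have -> : [seq x <- undup [seq i.*2 | i <- s] |
      x \notin [seq i.*2.+1 | i <- t]] = undup [seq i.*2 | i <- s].
    apply/all_filterP/allP => x; rewrite mem_undup => /mapP[i _ ->].
    by apply/negP => /mapP[j _ /(congr1 odd)]; rewrite /= !odd_double.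
  rewrite undup_map_inj ?size_map// => i j /eqP.
  by rewrite -!muln2 eqn_pmul2r// => /eqP.
have mpre D (f : coins -> coins) (mf : measurable_fun setT f) :
    measurable D -> measurable (f @^-1` D).
  by move=> mD; rewrite -[X in measurable X]setTI; exact: mf.
have half s B' : measurable B' -> fair (unzip @^-1` (cylinder s `*` B')) =
    (fair (cylinder s) * fair B')%E.
  move=> mB'; have ms := mpre _ _ mcut1 (measurable_cylinder s).
  pose mm : {measure set coins -> \bar R} :=
    measure_function_pushforward__canonical__measure_function_Measure
      (mrestr fair ms) mcut2.
  have <- : mm B' = fair (unzip @^-1` (cylinder s `*` B')).
    by rewrite /= /pushforward /mrestr setIC.
  rewrite fair_cylinder; apply: fair_unique => //.
  by move=> t; rewrite -fair_cylinder -fairc /= /pushforward /mrestr setIC.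
move=> mA mB; have mB' := mpre _ _ mcut2 mB.
pose mm : {measure set coins -> \bar R} :=
  measure_function_pushforward__canonical__measure_function_Measure
      (mrestr fair mB') mcut1.
have -> : fair (unzip @^-1` (A `*` B)) = mm A by [].
rewrite muleC -(fineK (fin_num_measure fair B mB)); apply: fair_unique => //.
  exact: fine_ge0.
by move=> t; rewrite fineK ?fin_num_measure// muleC -half.
Qed.

End fair_measure.

(** * Sampling a real law from the coins *)

Section sampling.
Variable R : realType.

Definition value (w : coins) : R :=
  fine (\sum_(i <oo) ((w i)%:R / 2 ^+ i.+1)%:E)%E.

Lemma measurable_value : measurable_fun setT value.
Proof.
apply: measurableT_comp => //; apply: ge0_emeasurable_sum => [i w _ _|i _].
  by rewrite lee_fin divr_ge0// exprn_ge0.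
apply/measurable_EFinP; apply: measurable_funM => //.
have -> : (fun w : coins => (w i)%:R : R) =
  (fun b : bool => b%:R) \o (fun w : coins => w i) by [].
by apply: measurableT_comp => //; exact: measurable_toss.
Qed.

(** By telescoping, since [truncn (2 ^+ n.+1 * x)] is twice [truncn (2 ^+ n * x)]
    plus the digit of rank [n]. *)
Lemma partial_value (x : R) n : 0 <= x < 1 ->
  \sum_(0 <= i < n) (digits x i)%:R / 2 ^+ i.+1 =
  (Num.truncn (2 ^+ n * x))%:R / 2 ^+ n :> R.
Proof.
move=> /andP[x0 x1]; elim: n => [|n IH].
  rewrite big_geq// expr0 mul1r divr1; apply/esym/eqP; rewrite pnatr_eq0.
  by rewrite truncn_eq// x0.
rewrite big_nat_recr//= IH /digits; set m := Num.truncn (2 ^+ n.+1 * x).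
have <- : m./2 = Num.truncn (2 ^+ n * x).
  by rewrite /m exprS -mulrA truncn_double// mulr_ge0// exprn_ge0.
rewrite -{3}(odd_double_half m) natrD -muln2 natrM exprS.
by field; rewrite expf_neq0.
Qed.

Lemma value_digits (x : R) : 0 <= x < 1 -> value (digits x) = x.
Proof.
move=> x01; rewrite /value.
suff -> : (\sum_(i <oo) ((digits x i)%:R / 2 ^+ i.+1)%:E = x%:E)%E by [].
apply/cvg_lim => //.
under eq_cvg do rewrite sumEFin partial_value//.
apply/fine_cvgP; split; first exact: nearW.
have x0 : 0 <= x by case/andP : x01.
apply: (@squeeze_cvgr _ _ _ _ (fun n => x - 2^-1 ^+ n) (cst x)) => /=.
- apply: nearW => n /=; have := @truncn_itv R (2 ^+ n * x).
  rewrite mulr_ge0 ?exprn_ge0// => /(_ isT)/andP[h1 h2].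
  rewrite ler_pdivrMr ?exprn_gt0// (mulrC x) h1 andbT.
  rewrite ler_pdivlMr ?exprn_gt0// mulrBl exprVn mulVf ?expf_neq0//.
  by rewrite lerBlDr natr1 mulrC ltW.
- rewrite -[X in _ --> X]subr0; apply: cvgB; first exact: cvg_cst.
  by apply: cvg_expr; rewrite ger0_norm ?invr_ge0// invf_lt1// ltr1n.
- exact: cvg_cst.
Qed.

(** The sequence [digits x] has value [x], so that the value of fair tosses is
    uniform. The point 1 has to be excluded: its digits are all zero. *)
Lemma fair_value (A : set R) : measurable A -> A `<=` `]0, 1[%classic ->
  fair R (value @^-1` A) = lebesgue_measure A.
Proof.
move=> mA A01; rewrite /fair /distribution /pushforward /=.
have := measurableT_comp measurable_value (@measurable_digits R) measurableT mA.
rewrite setTI => mV.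
set V := (value \o @digits R) @^-1` A in mV.
rewrite [X in uniform_prob _ X](_ : _ = V)// uniform_probE//.
have -> : V `&` `[0, 1] = A `|` (V `&` [set (1 : R)]).
  apply/seteqP; split => x /=; rewrite in_itv /=.
    move=> [Vx /andP[x0]]; rewrite le_eqVlt => /orP[/eqP x1|x1]; first by right.
    by left; move: Vx; rewrite /V /= value_digits ?x0.
  case=> [Ax|[Vx x1]]; last by split => //; rewrite x1 ler01 lexx.
  have := A01 _ Ax; rewrite /= in_itv /= => /andP[x0 x1].
  by rewrite (ltW x0) (ltW x1); split => //; rewrite /V /= value_digits// (ltW x0).
apply: measureU0 => //; first by apply: measurableI => //; exact: measurable_set1.
apply/eqP; rewrite eq_le measure_ge0 andbT.
rewrite -(lebesgue_measure_set1 (1:R)); apply: le_measure; rewrite ?inE.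
- by apply: measurableI => //; exact: measurable_set1.
- exact: measurable_set1.
- exact: subIsetr.
Qed.

Section quantile.
Context d (T : measurableType d) (P : probability T R) (X : {RV P >-> R}).

Definition quantile (u : R) : R := inf [set x | (u%:E <= cdf X x)%E].

(** The infimum is attained because a distribution function is right
    continuous. *)
Lemma quantile_le (u t : R) : 0 < u < 1 ->
  (quantile u <= t) = (u%:E <= cdf X t)%E.
Proof.
move=> /andP[u0 u1]; set A := [set x | (u%:E <= cdf X x)%E].
have lA : has_lbound A.
  have h0 : nbhs (0%E : \bar R) [set y | (y < u%:E)%E].
    by apply: open_ereal_lt'; rewrite lte_fin.
  have := cvg_cdfNy0 X h0; move=> [M [_ h]]; exists M => x Ax; rewrite leNgt; apply/negP => /h /=.
  by rewrite ltNge; move: Ax; rewrite /A /= => ->.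
have A0 : A !=set0.
  have h1 : nbhs (1%E : \bar R) [set y | (u%:E < y)%E].
    by apply: open_ereal_gt'; rewrite lte_fin.
  have := cvg_cdfy1 X h1; move=> [M [_ h]]; exists (M + 1); rewrite /A /=; apply/ltW/h.
  by rewrite ltrDl.
apply/idP/idP => [qt|ut]; last exact: ge_inf.
apply: (cvge_to_ge (@cdf_right_continuous _ _ _ _ X t)).
near=> x.
have tx : t < x by near: x; exact: nbhs_right_gt.
have hA : has_inf A by split.
have [e Ae] := inf_adherent (eps := x - t) ltac:(by rewrite subr_gt0) hA.
move=> ex; apply: (le_trans Ae); apply: cdf_nondecreasing.
apply/ltW/(lt_le_trans ex); rewrite -/(quantile u).
by rewrite -lerBrDr opprB addrC subrK.
Unshelve. all: by end_near. Qed.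

(** Quantile transform of a uniform variable. *)
Lemma fair_sample : exists2 Y : coins -> R, measurable_fun setT Y &
  forall A, measurable A -> fair R (Y @^-1` A) = P (X @^-1` A).
Proof.
pose Y w := if 0 < value w < 1 then quantile (value w) else 0.
(* [value] is almost surely in the open unit interval; the value 0 outside
   only serves to make [Y] a real function. *)
have YE t : Y @^-1` `]-oo, t] =
   value @^-1` (`]0, 1[ `&` [set u | (u%:E <= cdf X t)%E]) `|`
   value @^-1` (~` `]0, 1[ `&` [set _ | 0 <= t]).
  apply/seteqP; split => w; rewrite /Y /= ?in_itv /=.
    case: ifPn => [w01|w01 t0]; first by rewrite quantile_le//; left.
    by right; split => //; exact/negP.
  case=> -[]; first by move=> w01; rewrite w01 quantile_le.
  by move/negP/negbTE ->.
have mray t : measurable [set u | (u%:E <= cdf X t)%E].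
  rewrite [X in measurable X](_ : _ = `]-oo, fine (cdf X t)]%classic).
    exact: measurable_itv.
  apply/seteqP; split => u /=; rewrite in_itv /= -lee_fin fineK//;
    exact: fin_num_measure.
have mpre A : measurable A -> measurable (value @^-1` A).
  by move=> mA; rewrite -[X in measurable X]setTI; exact: measurable_value.
have m2 t : measurable (~` `]0, 1[ `&` [set _ : R | 0 <= t]).
  apply: measurableI; first by apply: measurableC; exact: measurable_itv.
  case: (0 <= t).
    rewrite [X in measurable X](_ : _ = setT); first exact: measurableT.
    by apply/seteqP; split.
  by rewrite [X in measurable X](_ : _ = set0)//; apply/seteqP; split.
have m1 t : measurable (`]0, 1[ `&` [set u | (u%:E <= cdf X t)%E]).
  by apply: measurableI => //; exact: measurable_itv.
have mYr t : measurable (Y @^-1` `]-oo, t]).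
  by rewrite YE; apply: measurableU; exact: mpre.
have mY : measurable_fun setT Y.
  apply: (@measurability _ _ _ _ _ _ (@RGenOInfty.G R)).
    exact: RGenOInfty.measurableE.
  move=> _ [_ [t ->] <-]; rewrite setTI -setCitvl preimage_setC.
  by apply: measurableC; exact: mYr.
exists Y => // A mA.
pose mm1 : {measure set R -> \bar R} :=
  measure_function_pushforward__canonical__measure_function_Measure (fair R) mY.
pose mm2 : {measure set R -> \bar R} := distribution P X.
have -> : fair R (Y @^-1` A) = mm1 A by [].
have -> : P (X @^-1` A) = mm2 A by [].
have fYt t : fair R (Y @^-1` `]-oo, t]) = cdf X t.
  rewrite YE measureU0; [|exact: mpre|exact: mpre|].
    apply: etrans (fair_value (m1 t) (@subIsetl _ _ _)) _.
    have F1 := cdf_le1 X t; have F0 := cdf_ge0 X t.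
    have fF : cdf X t \is a fin_num by exact: fin_num_measure.
    move: F0 F1; rewrite -(fineK fF) !lee_fin; set f := fine _ => F0.
    rewrite le_eqVlt => /orP[/eqP ->|F1].
      rewrite (_ : _ `&` _ = `]0, 1[%classic) ?lebesgue_measure_itv/=.
        by rewrite lte_fin ltr01 oppr0 adde0.
      by apply/seteqP; split => [x []//|x x01]; split => //=; move: x01;
        rewrite /= in_itv /= lee_fin => /andP[_ /ltW].
    rewrite (_ : _ `&` _ = `]0, f]%classic) ?lebesgue_measure_itv/=.
      by move: F0; rewrite lte_fin le_eqVlt => /orP[/eqP <-|->];
        rewrite ?ltxx// oppr0 adde0.
    apply/seteqP; split => x /=; rewrite !in_itv /= lee_fin.
      by move=> [/andP[-> _] ->].
    by move=> /andP[-> xf]; rewrite xf (le_lt_trans xf).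
  apply/eqP; rewrite eq_le measure_ge0 andbT.
  apply: (@le_trans _ _ (fair R (value @^-1` (~` `]0, 1[)))).
    apply: le_measure; rewrite ?inE; [exact: mpre|apply: mpre|].
      exact: (measurableC (measurable_itv _)).
    by move=> x [].
  rewrite preimage_setC probability_setC; last exact: mpre (measurable_itv _).
  rewrite [X in (_ - X)%E](fair_value (measurable_itv _))//.
  by rewrite lebesgue_measure_itv /= lte_fin ltr01 oppr0 adde0 subee.
apply: (@measure_unique _ R R (@RGenOInfty.G R) (fun n => `]- n%:R, +oo[%classic)).
- exact: RGenOInfty.measurableE.
- move=> _ _ [x ->] [y ->]; exists (Num.max x y).
  by apply/seteqP; split => z /=; rewrite !in_itv /= !andbT gt_max => /andP.
- by move=> n; exists (- n%:R).
- apply/seteqP; split => // x _; exists (Num.truncn (- x)).+1 => //=.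
  by rewrite in_itv /= andbT ltrNl truncnS_gt.
- move=> _ [t ->]; rewrite -setCitvl.
  have mXt : measurable (X @^-1` `]-oo, t]) by exact: measurable_funPTI.
  rewrite [LHS](probability_setC (fair R) (mYr t)).
  by rewrite [RHS](probability_setC P mXt); congr (_ - _)%E; exact: fYt.
- move=> n; apply: le_lt_trans (ltry 1).
  apply: (@probability_le1 _ _ _ (fair R)).
  have := mY measurableT `]- n%:R, +oo[%classic (measurable_itv _).
  by rewrite setTI.
- by [].
Qed.
End quantile.
End sampling.

(** * Real integrals of bounded functions *)

Section bounded_integral.
Context d (T : measurableType d) (R : realType) (P : probability T R).

Lemma bounded_integrable (M : R) (f : T -> R) : measurable_fun setT f ->
  (forall x, `|f x| <= M) -> P.-integrable setT (EFin \o f).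
Proof.
move=> mf fM; apply: measurable_bounded_integrable => //.
  by rewrite (le_lt_trans (probability_le1 _ _)) ?ltry.
exists M; split; [exact: num_real|move=> y My x _].
exact: le_trans (fM x) (ltW My).
Qed.

Lemma integralE_bounded (M : R) (f : T -> R) : measurable_fun setT f ->
  (forall x, `|f x| <= M) -> (\int[P]_x (f x)%:E = (\int[P]_x f x)%:E)%E.
Proof.
move=> mf fM; rewrite fineK// integrable_fin_num//.
exact: bounded_integrable mf fM.
Qed.

Lemma Rintegral_cstP (c : R) : \int[P]_x c = c.
Proof. by rewrite Rintegral_cst// [X in fine X](@probability_setT _ _ _ P) mulr1. Qed.

Lemma Rintegral_bound (M : R) (f : T -> R) : measurable_fun setT f ->
  (forall x, `|f x| <= M) -> `|\int[P]_x f x| <= M.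
Proof.
move=> mf fM; apply: le_trans (le_normr_Rintegral _ _) _ => //.
  exact: bounded_integrable mf fM.
rewrite -[leRHS]Rintegral_cstP; apply: le_Rintegral => //.
- apply: (@bounded_integrable M); first exact: measurableT_comp.
  by move=> x; rewrite normr_id.
- by apply: finite_measure_integrable_cst.
Qed.

Lemma Rdominated_convergence (M : R) (f : (T -> R)^nat) (g : T -> R) :
  (forall n, measurable_fun setT (f n)) -> measurable_fun setT g ->
  (forall n x, `|f n x| <= M) -> {ae P, forall x, f n x @[n --> \oo] --> g x} ->
  \int[P]_x f n x @[n --> \oo] --> \int[P]_x g x.
Proof.
move=> mf mg fM fg.
have [] := @dominated_convergence _ T R P setT measurableT
   (fun n => EFin \o f n) (EFin \o g) (EFin \o cst M).
- by move=> n; exact/measurable_EFinP.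
- exact/measurable_EFinP.
- by move: fg; apply: filterS => x h _; apply/fine_cvgP; split; [exact: nearW|].
- exact: finite_measure_integrable_cst.
- by apply: aeW => x n _; rewrite /= lee_fin.
move=> ig _ cg; apply: fine_cvg; rewrite fineK ?integrable_fin_num//.
Qed.

End bounded_integral.

Section product_probability.
Context d (Om : measurableType d) (R : realType) (P : probability Om R).
Variable cut : Om -> Om * Om.
Hypothesis mcut : measurable_fun setT cut.
Hypothesis Pcut : forall A B, measurable A -> measurable B ->
  P (cut @^-1` (A `*` B)) = (P A * P B)%E.

(** The map [cut] sends a random element to two independent copies of it, so the
    law of [cut w] is the product [P \x P], to which Fubini applies. *)
Lemma Rintegral_cut (M : R) (F : Om * Om -> R) : measurable_fun setT F ->
  (forall z, `|F z| <= M) ->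
  \int[P]_w F (cut w) = \int[P]_x \int[P]_y F (x, y).
Proof.
move=> mF FM.
pose Q : {measure set (Om * Om) -> \bar R} :=
  measure_function_pushforward__canonical__measure_function_Measure P mcut.
have QE A : measurable A -> (P \x P)%E A = Q A.
  by apply: product_measure_unique => *; exact: Pcut.
have iF : (P \x P)%E.-integrable setT (EFin \o F).
  exact: (@bounded_integrable _ _ R _ M).
have iFc : P.-integrable setT ((EFin \o F) \o cut).
  apply: (@bounded_integrable _ _ R P M) => //; exact: measurableT_comp.
rewrite /Rintegral; congr fine.
transitivity (\int[Q]_z (F z)%:E)%E.
  rewrite (integral_pushforward mcut)//; exact/measurable_EFinP.
transitivity (\int[P \x P]_z (F z)%:E)%E.
  by apply/esym/eq_measure_integral => A mA _; exact: QE.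
rewrite -integral12_prod_meas1//; apply: eq_integral => x _ /=.
apply: (@integralE_bounded _ _ R P M) => //.
exact: (measurable_fun_pair2 x mF).
Qed.

Lemma measurable_Rintegral2 (M : R) (F : Om * Om -> R) : measurable_fun setT F ->
  (forall z, `|F z| <= M) ->
  measurable_fun setT (fun x => \int[P]_y F (x, y)).
Proof.
move=> mF FM; apply: measurableT_comp => //.
apply: (@measurable_fubini_F _ _ _ _ R P P (EFin \o F)).
exact: (@bounded_integrable _ _ R (P \x P)%E M).
Qed.

Lemma Rintegral_prod (M N : R) (u v : Om -> R) : measurable_fun setT u ->
  measurable_fun setT v -> (forall x, `|u x| <= M) -> (forall x, `|v x| <= N) ->
  \int[P]_w (u (cut w).1 * v (cut w).2) = \int[P]_x u x * \int[P]_x v x.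
Proof.
move=> mu mv uM vN.
rewrite (@Rintegral_cut (M * N) (fun z => u z.1 * v z.2)); last 2 first.
- by apply: measurable_funM; exact: measurableT_comp.
- by move=> z; rewrite normrM ler_pM.
rewrite -RintegralZr//; last exact: bounded_integrable mu uM.
apply: eq_Rintegral => x _ /=; rewrite RintegralZl//.
exact: bounded_integrable mv vN.
Qed.

End product_probability.

(** * Real characteristic functions and independent sums *)

Section characteristic_function.
Context d (T : measurableType d) (R : realType) (P : probability T R).

(** The characteristic function of [X] at 1 is the real number [c]. Applied to
    linear combinations, this covers joint characteristic functions, and all
    the laws considered below are symmetric. *)
Definition real_cf (X : T -> R) (c : R) :=
  \int[P]_w cos (X w) = c /\ \int[P]_w sin (X w) = 0.

Lemma measurable_cos : measurable_fun setT (@cos R).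
Proof. exact: (continuous_measurable_fun (@continuous_cos R)). Qed.

Lemma measurable_sin : measurable_fun setT (@sin R).
Proof. exact: (continuous_measurable_fun (@continuous_sin R)). Qed.

Lemma integrable_cos X : measurable_fun setT X ->
  P.-integrable setT (EFin \o (fun w => cos (X w))).
Proof.
move=> mX; apply: (@bounded_integrable _ _ _ _ 1) => [|x]; last exact: cos_max.
by apply: measurableT_comp => //; exact: measurable_cos.
Qed.

Lemma real_cf0 : real_cf (cst 0) 1.
Proof.
by split; [rewrite -[RHS](Rintegral_cstP P)|rewrite -[RHS](Rintegral_cstP P)];
  apply: eq_Rintegral => w _; rewrite ?cos0 ?sin0.
Qed.

End characteristic_function.

Section independent_sums.
Context d (Om : measurableType d) (R : realType) (P : probability Om R).
Variable cut : Om -> Om * Om.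
Hypothesis mcut : measurable_fun setT cut.
Hypothesis Pcut : forall A B, measurable A -> measurable B ->
  P (cut @^-1` (A `*` B)) = (P A * P B)%E.

Lemma measurable_cut1 : measurable_fun setT (fun w => (cut w).1).
Proof. exact: measurableT_comp. Qed.

Lemma measurable_cut2 : measurable_fun setT (fun w => (cut w).2).
Proof. exact: measurableT_comp. Qed.

(** Addition formulas; the two terms depend on independent halves. *)
Lemma real_cfD (X Y : Om -> R) a b : measurable_fun setT X -> measurable_fun setT Y ->
  real_cf P X a -> real_cf P Y b ->
  real_cf P (fun w => X (cut w).1 + Y (cut w).2) (a * b).
Proof.
move=> mX mY [Xa X0] [Yb Y0].
have mc1 := measurableT_comp (@measurable_cos R) mX.
have mc2 := measurableT_comp (@measurable_cos R) mY.
have ms1 := measurableT_comp (@measurable_sin R) mX.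
have ms2 := measurableT_comp (@measurable_sin R) mY.
have ip (u v : Om -> R) : measurable_fun setT u -> measurable_fun setT v ->
    (forall x, `|u x| <= 1) -> (forall x, `|v x| <= 1) ->
    P.-integrable setT (EFin \o (fun w => u (cut w).1 * v (cut w).2 : R)).
  move=> mu mv u1 v1; apply: (@bounded_integrable _ _ _ _ 1).
    apply: measurable_funM; [exact: measurableT_comp measurable_cut1|].
    exact: measurableT_comp measurable_cut2.
  by move=> x; rewrite normrM -[1]mulr1 ler_pM.
have cb (Z : Om -> R) x : `|(cos \o Z) x| <= 1 by exact: cos_max.
have sb (Z : Om -> R) x : `|(sin \o Z) x| <= 1 by exact: sin_max.
have E u v := @Rintegral_prod _ _ _ P cut mcut Pcut 1 1 u v.
split.
  under eq_Rintegral do rewrite cosD.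
  rewrite RintegralB//; [|exact: (ip _ _ mc1 mc2 (cb X) (cb Y))|exact: (ip _ _ ms1 ms2 (sb X) (sb Y))].
  rewrite (E (cos \o X) (cos \o Y))// (E (sin \o X) (sin \o Y))//.
  by rewrite Xa Yb X0 mul0r subr0.
under eq_Rintegral do rewrite sinD.
rewrite RintegralD//; [|exact: (ip _ _ ms1 mc2 (sb X) (cb Y))|exact: (ip _ _ mc1 ms2 (cb X) (sb Y))].
rewrite (E (sin \o X) (cos \o Y))// (E (cos \o X) (sin \o Y))//.
by rewrite X0 Y0 mul0r mulr0 addr0.
Qed.

(** The terms are made independent by giving to each of them the first half of
    the randomness that its predecessors leave. A term is then read from the
    same part of [w] for all lengths of the sum. *)
Fixpoint isum n (Z : nat -> Om -> R) (w : Om) : R :=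
  if n is n'.+1 then Z 0%N (cut w).1 + isum n' (fun k => Z k.+1) (cut w).2
  else 0.

Lemma measurable_isum n Z : (forall k, measurable_fun setT (Z k)) ->
  measurable_fun setT (isum n Z).
Proof.
elim: n Z => [|n IH] Z mZ /=; first exact: measurable_cst.
apply: measurable_funD; first exact: measurableT_comp measurable_cut1.
by apply: measurableT_comp measurable_cut2; exact: IH.
Qed.

Lemma real_cf_isum n Z c : (forall k, measurable_fun setT (Z k)) ->
  (forall k, real_cf P (Z k) (c k)) ->
  real_cf P (isum n Z) (\prod_(k < n) c k).
Proof.
elim: n Z c => [|n IH] Z c mZ Zc /=; first by rewrite big_ord0; exact: real_cf0.
rewrite big_ord_recl; apply: real_cfD => //; first exact: measurable_isum.
by apply: (IH _ (fun k => c k.+1)).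
Qed.

Lemma isum_linear n I (r : seq I) (theta : I -> R) (Z : I -> nat -> Om -> R) w :
  \sum_(i <- r) theta i * isum n (Z i) w =
  isum n (fun k w => \sum_(i <- r) theta i * Z i k w) w.
Proof.
elim: n Z w => [|n IH] Z w /=; first by rewrite big1// => i _; rewrite mulr0.
by under eq_bigr do rewrite mulrDr; rewrite big_split /= IH.
Qed.

(** This turns an increment of the partial sums into an independent sum. *)
Lemma isumB m n Z w : (n <= m)%N ->
  isum m Z w - isum n Z w = isum m (fun k => if (k < n)%N then cst 0 else Z k) w.
Proof.
elim: m n Z w => [|m IH] [|n] Z w //= nm; rewrite ?subrr ?subr0//.
by rewrite opprD addrACA subrr !add0r IH.
Qed.

End independent_sums.

(** * Realizable exponents *)

Section realizable.
Context d (Om : measurableType d) (R : realType) (P : probability Om R).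
Variable cut : Om -> Om * Om.
Hypothesis mcut : measurable_fun setT cut.
Hypothesis Pcut : forall A B, measurable A -> measurable B ->
  P (cut @^-1` (A `*` B)) = (P A * P B)%E.

(** [psi] is minus the logarithm of the characteristic function of a process
    indexed by [V], evaluated at linear combinations of indices. *)
Definition realizable (V : set (R -> R)) (psi : (R -> R) -> R) :=
  exists2 I : (R -> R) -> Om -> R,
    (forall f, V f -> measurable_fun setT (I f)) &
    forall n (f : 'I_n -> R -> R) (theta : 'I_n -> R), (forall j, V (f j)) ->
      real_cf P (fun w => \sum_(j < n) theta j * I (f j) w)
        (expR (- psi (fun x => \sum_(j < n) theta j * f j x))).

Lemma measurable_switch (N : Om -> nat) (F : nat -> Om -> R) :
  measurable_fun setT N -> (forall n, measurable_fun setT (F n)) ->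
  measurable_fun setT (fun z : Om * Om => F (N z.1) z.2).
Proof.
move=> mN mF _ A mA; rewrite setTI.
have -> : (fun z : Om * Om => F (N z.1) z.2) @^-1` A =
    \bigcup_n ((fun z => N z.1) @^-1` [set n] `&` (fun z => F n z.2) @^-1` A).
  by apply/seteqP; split=> z /=; [exists (N z.1)|move=> [n _ /= [-> ]]].
apply: bigcupT_measurable => n; apply: measurableI.
  rewrite -[X in measurable X]setTI.
  by apply: (measurableT_comp mN measurable_fst) => //.
rewrite -[X in measurable X]setTI.
exact: (measurableT_comp (mF n) measurable_snd).
Qed.

Section poisson.
Variable N : Om -> nat.
Hypothesis mN : measurable_fun setT N.
Hypothesis PN : forall n, P (N @^-1` [set n]) = (poisson_pmf 1 n)%:E.

(** Summing over the values of [N] gives the exponential series of [phi],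
    multiplied by [exp (- 1)]. *)
Lemma poisson_generating (phi : R) : 0 <= phi <= 1 ->
  \int[P]_w phi ^+ N w = expR (phi - 1).
Proof.
move=> /andP[p0 p1]; rewrite /Rintegral.
suff -> : (\int[P]_w (phi ^+ N w)%:E = (expR (phi - 1))%:E)%E by [].
have mNn n : measurable (N @^-1` [set n]).
  by rewrite -[X in measurable X]setTI; exact: mN.
transitivity (\int[P]_w \sum_(n <oo) (phi ^+ n * \1_(N @^-1` [set n]) w)%:E)%E.
  apply: eq_integral => w _; rewrite (@nneseriesD1 _ _ (N w))//; last first.
    by move=> n; rewrite lee_fin mulr_ge0// exprn_ge0.
  rewrite indicE mem_set//= mulr1 eseries0 ?adde0// => n _ /= nN.
  by rewrite indicE memNset ?mulr0// => /esym/eqP; rewrite (negbTE nN).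
rewrite integral_nneseries//; last 2 first.
- by move=> n; apply/measurable_EFinP; apply: measurable_funM.
- by move=> n w _; rewrite lee_fin mulr_ge0// exprn_ge0.
transitivity (\sum_(n <oo) ((expR (-1))%:E * (exp_coeff phi n)%:E))%E.
  apply: eq_eseriesr => n _; under eq_integral do rewrite EFinM.
  rewrite ge0_integralZl//; last 2 first.
  - exact/measurable_EFinP.
  - by rewrite lee_fin exprn_ge0.
  rewrite integral_indic// setIT [X in (_ * X)%E]PN /poisson_pmf ltr01.
  by rewrite expr1n mul1r -!EFinM /exp_coeff /= mulrA mulrC.
rewrite nneseriesZl/=; last first.
  by move=> n _; rewrite lee_fin divr_ge0// exprn_ge0.
rewrite expRD mulrC EFinM; congr *%E.
rewrite /expR -EFin_lim; last exact: is_cvg_series_exp_coeff.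
by apply/congr_lim/funext => n /=; rewrite /series/= -sumEFin.
Qed.

Definition poissonized (L : Om -> R) (w : Om) : R :=
  isum cut (N (cut w).1) (fun=> L) (cut w).2.

Lemma measurable_poissonized L : measurable_fun setT L ->
  measurable_fun setT (poissonized L).
Proof.
move=> mL.
have mF := measurable_switch mN (fun n => measurable_isum mcut n (fun=> mL)).
exact: measurableT_comp mF mcut.
Qed.

(** Given [N = n], the sum of [n] independent copies of [L] has characteristic
    function [phi ^+ n]; averaging over [N] gives the generating function. *)
Lemma real_cf_poissonized L phi : measurable_fun setT L -> 0 <= phi <= 1 ->
  real_cf P L phi -> real_cf P (poissonized L) (expR (phi - 1)).
Proof.
move=> mL p01 Lphi; rewrite -(poisson_generating p01).
have Ln n : real_cf P (isum cut n (fun=> L)) (phi ^+ n).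
  have := @real_cf_isum _ _ _ P cut mcut Pcut n (fun=> L) (fun=> phi).
  by rewrite prodr_const card_ord; apply.
have mF := measurable_switch mN (fun n => measurable_isum mcut n (fun=> mL)).
split.
  rewrite (@Rintegral_cut _ _ _ P cut mcut Pcut 1
    (fun z => cos (isum cut (N z.1) (fun=> L) z.2))) => [| |z]; last exact: cos_max.
    by apply: eq_Rintegral => x _; exact: (Ln (N x)).1.
  exact: (measurableT_comp (@measurable_cos R) mF).
rewrite (@Rintegral_cut _ _ _ P cut mcut Pcut 1
  (fun z => sin (isum cut (N z.1) (fun=> L) z.2))) => [| |z]; last exact: sin_max.
  rewrite -[RHS](Rintegral_cstP P).
  by apply: eq_Rintegral => x _; exact: (Ln (N x)).2.
exact: (measurableT_comp (@measurable_sin R) mF).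
Qed.

(** If [L] is linear, so is its compound Poisson sum, since the same number and
    places of the jumps are used for all [f]. Hence the one-dimensional
    computation suffices. *)
Lemma realizable_poisson (V : set (R -> R)) (L : (R -> R) -> Om -> R)
    (phi : (R -> R) -> R) :
  (forall f, V f -> measurable_fun setT (L f)) ->
  (forall n (f : 'I_n -> R -> R) theta, (forall j, V (f j)) ->
    V (fun x => \sum_(j < n) theta j * f j x)) ->
  (forall n (f : 'I_n -> R -> R) theta w,
    L (fun x => \sum_(j < n) theta j * f j x) w = \sum_(j < n) theta j * L (f j) w) ->
  (forall f, V f -> 0 <= phi f <= 1) ->
  (forall f, V f -> real_cf P (L f) (phi f)) ->
  realizable V (fun f => 1 - phi f).
Proof.
move=> mL VL LL phi01 Lphi; exists (fun f => poissonized (L f)) => [f Vf|n f theta Vf].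
  exact/measurable_poissonized/mL.
set g : R -> R := (fun x : R => _); have Vg : V g by exact: VL.
rewrite opprB; have -> : (fun w => \sum_(j < n) theta j * poissonized (L (f j)) w) =
    poissonized (L g).
  apply/funext => w; rewrite /poissonized isum_linear; congr (isum _ _ _ _).
  by apply/funext => k; apply/funext => w'; rewrite LL.
by apply: real_cf_poissonized; [exact: mL|exact: phi01|exact: Lphi].
Qed.

End poisson.

Lemma realizable_gauss (V : set (R -> R)) (G : Om -> R) (l : (R -> R) -> R) :
  measurable_fun setT G ->
  (forall t : R, real_cf P (fun w => t * G w) (expR (- (t ^+ 2 / 2)))) ->
  (forall n (f : 'I_n -> R -> R) theta, (forall j, V (f j)) ->
    l (fun x => \sum_(j < n) theta j * f j x) = \sum_(j < n) theta j * l (f j)) ->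
  realizable V (fun f => l f ^+ 2).
Proof.
move=> mG GG ll; exists (fun f w => Num.sqrt 2 * l f * G w) => [f _|n f theta Vf].
  exact: measurable_funM.
rewrite ll//; set s := \sum_(j < n) _.
have -> : (fun w => \sum_(j < n) theta j * (Num.sqrt 2 * l (f j) * G w)) =
    (fun w => Num.sqrt 2 * s * G w).
  apply/funext => w; rewrite mulr_sumr mulr_suml.
  by apply: eq_bigr => j _; ring.
suff -> : s ^+ 2 = (Num.sqrt 2 * s) ^+ 2 / 2 by exact: GG.
by rewrite exprMn sqr_sqrtr// mulrC mulKf.
Qed.

End realizable.

(** * The standard normal law *)

Section gaussian_cf.
Variable R : realType.
Local Notation mu := (@lebesgue_measure R).
Implicit Types t x c : R.

Let g x : R := expR (- (x ^+ 2 / 2)).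

Let g_pdf x : normal_pdf 0 1 x = @normal_peak R 1 * g x.
Proof.
by rewrite normal_pdfE// /normal_fun /g subr0 expr1n mulNr.
Qed.

Let g_gt0 x : 0 < g x. Proof. exact: expR_gt0. Qed.

Let g_integrable : mu.-integrable setT (EFin \o g).
Proof.
have := @integrable_normal_pdf R 0 1.
have k0 : @normal_peak R 1 != 0 by rewrite gt_eqF// normal_peak_gt0.
move=> /(@integrableZl _ _ _ mu setT measurableT (@normal_peak R 1)^-1).
apply: eq_integrable => // x _; rewrite g_pdf -EFinM mulKf//.
Qed.

Let xg_integrable : mu.-integrable setT (EFin \o (fun x => `|x| * g x)).
Proof.
have := @integrable_normal_pdf R 0 (Num.sqrt 2).
have s2 : Num.sqrt 2 != 0 :> R by rewrite gt_eqF// sqrtr_gt0.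
have k0 : @normal_peak R (Num.sqrt 2) != 0 by rewrite gt_eqF// normal_peak_gt0.
move=> /(@integrableZl _ _ _ mu setT measurableT (@normal_peak R (Num.sqrt 2))^-1).
apply: le_integrable => //.
  apply/measurable_EFinP; apply: measurable_funM => //.
  rewrite /g; apply: measurableT_comp => //; apply: measurable_funN.
  apply: measurable_funM => //.
move=> x _; rewrite normal_pdfE// -EFinM mulKf// /normal_fun subr0 sqr_sqrtr//=.
rewrite lee_fin (ger0_norm (expR_ge0 _)) normrM normr_id (gtr0_norm (g_gt0 x)).
rewrite -ler_pdivlMr// /g -expRN opprK -expRD.
have -> : - x ^+ 2 / (2 *+ 2) + x ^+ 2 / 2 = x ^+ 2 / 4 by field.
apply: le_trans (expR_ge1Dx _).
by have := sqr_ge0 (`|x| - 2); rewrite -(real_normK (num_real x)); nra.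
Qed.

Let cg_bound c t x : `|cos (t * x + c) * g x| <= g x.
Proof. by rewrite normrM (gtr0_norm (g_gt0 x)) ler_piMl ?cos_max// ltW. Qed.

Let mg : measurable_fun setT g.
Proof. by apply/measurable_EFinP; exact: measurable_int g_integrable. Qed.

Let mlin c t : measurable_fun setT (fun x => t * x + c).
Proof. by apply: measurable_funD => //; exact: mulrl_measurable. Qed.

Let mcos c t : measurable_fun setT (fun x => cos (t * x + c)).
Proof. exact: measurableT_comp (@measurable_cos R) (mlin c t). Qed.

Let msin c t : measurable_fun setT (fun x => sin (t * x + c)).
Proof. exact: measurableT_comp (@measurable_sin R) (mlin c t). Qed.

Let cg_integrable c t :
  mu.-integrable setT (EFin \o (fun x => cos (t * x + c) * g x)).
Proof.
apply: le_integrable g_integrable => //.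
  by apply/measurable_EFinP; apply: measurable_funM; [exact: mcos|exact: mg].
by move=> x _ /=; rewrite lee_fin (gtr0_norm (g_gt0 x)).
Qed.

Let xsg_integrable c t :
  mu.-integrable setT (EFin \o (fun x => x * sin (t * x + c) * g x)).
Proof.
apply: le_integrable xg_integrable => //.
  apply/measurable_EFinP; apply: measurable_funM; last exact: mg.
  by apply: measurable_funM => //; exact: msin.
move=> x _ /=; rewrite lee_fin !normrM normr_id ler_pM2r ?normr_gt0 ?gt_eqF//.
by rewrite ler_piMr// sin_max.
Qed.

(** The phase [c] treats cosine and sine together: the sine is a cosine with phase
    [- pi / 2]. *)
Let F c t := \int[mu]_x (cos (t * x + c) * g x).

Let is_derive_F c t : is_derive t 1 (F c) (- \int[mu]_x (x * sin (t * x + c) * g x)).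
Proof.
pose f s x := cos (s * x + c) * g x.
have df (s x : R) : is_derive s 1 (f^~ x) (- (x * sin (s * x + c) * g x)).
  by rewrite /f; apply: is_derive_eq; rewrite /GRing.scale /=; ring.
have d1 s x : partial1of2 f s x = - (x * sin (s * x + c) * g x).
  by rewrite partial1of2E; exact: derive_val.
have It : `]t - 1, t + 1[%classic t by rewrite /= in_itv /= ltrBlDr ltrDl ltr01.
have I1 s : `]t - 1, t + 1[%classic s -> mu.-integrable setT (EFin \o f s).
  by move=> _; exact: cg_integrable.
have I2 s x : `]t - 1, t + 1[%classic s -> setT x -> derivable (f^~ x) s 1.
  by move=> _ _; exact: ex_derive.
have G0 x : 0 <= `|x| * g x by rewrite mulr_ge0// ltW.
have I3 s x : `]t - 1, t + 1[%classic s -> setT x ->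
    `|partial1of2 f s x| <= `|x| * g x.
  move=> _ _; rewrite d1 normrN !normrM (gtr0_norm (g_gt0 x)).
  by rewrite ler_pM2r// ler_piMr// sin_max.
have dF := derivable_under_integral measurableT It I1 I2 G0 xg_integrable I3.
have FE := differentiation_under_integral measurableT It I1 I2 G0 xg_integrable I3.
apply: DeriveDef => //; rewrite -derive1E [LHS]FE.
under eq_Rintegral do rewrite d1.
rewrite -[RHS]mulN1r -RintegralZl//.
by apply: eq_Rintegral => x _; rewrite mulN1r.
Qed.

(** The two sides differ by the integral over the line of the derivative of
    [sin (t * x + c) * g x], a function that vanishes at infinity. *)
Let by_parts c t : \int[mu]_x (x * sin (t * x + c) * g x) = t * F c t.
Proof.
pose h x := sin (t * x + c) * g x.
pose h' x := t * (cos (t * x + c) * g x) - x * sin (t * x + c) * g x.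
have dh (x : R) : is_derive x 1 h (h' x).
  by rewrite /h; apply: is_derive_eq; rewrite /h' /GRing.scale /= -/(g x); field.
have ih' : mu.-integrable setT (EFin \o h').
  apply: eq_integrable (integrableB measurableT
    (integrableZl measurableT t (cg_integrable c t)) (xsg_integrable c t)) => //.
suff h0 : \int[mu]_x h' x = 0.
  apply/esym/eqP; rewrite -subr_eq0 -RintegralZl//.
  rewrite -RintegralB//; first exact/eqP.
  by apply: eq_integrable (integrableZl measurableT t (cg_integrable c t)).
pose K n := `[- n.+1%:R, n.+1%:R : R]%classic.
have ch' : continuous h'.
  move=> x; apply: differentiable_continuous; apply/derivable1_diffP.
  by rewrite /h'; exact: ex_derive.
have hK n : (\int[mu]_(x in K n) (h' x)%:E = (h n.+1%:R - h (- n.+1%:R))%:E)%E.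
  rewrite EFinB; apply: continuous_FTC2.
  - by rewrite ltrNl (lt_trans _ (ltr0Sn _ _))// oppr_lt0.
  - exact: continuous_subspaceT.
  - split; first by move=> x _; exact: ex_derive.
    + apply: cvg_at_right_filter; apply: differentiable_continuous.
      by apply/derivable1_diffP; exact: ex_derive.
    + apply: cvg_at_left_filter; apply: differentiable_continuous.
      by apply/derivable1_diffP; exact: ex_derive.
  - by move=> x _; rewrite derive1E; exact: derive_val.
have c1 : (\int[mu]_(x in K n) (h' x)%:E @[n --> \oo] --> \int[mu]_x (h' x)%:E)%E.
  have mh' : measurable_fun setT (EFin \o h') by exact: measurable_int ih'.
  have [] := @dominated_convergence _ _ R mu setT measurableT
    (fun n => (EFin \o h') \_ (K n)) (EFin \o h') (abse \o (EFin \o h')).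
  - move=> n; have mK : measurable (K n : set (measurableTypeR R)).
      exact: measurable_itv.
    apply/(measurable_restrictT _ mK).
    exact: measurable_funTS mh'.
  - exact: mh'.
  - apply: aeW => x _; apply: cvg_near_cst; exists (Num.truncn `|x|) => // n /= xn.
    rewrite patchE mem_set// /K /= in_itv /= -ler_norml.
    by apply/ltW; apply: lt_le_trans (truncnS_gt _) _; rewrite ler_nat.
  - exact: integrable_abse ih'.
  - apply: aeW => x n _; rewrite patchE; case: ifP => //= _.
    by rewrite normr0 lee_fin.
  by move=> _ _ H; under eq_cvg do rewrite integral_mkcond; exact: H.
have c0 : (h n.+1%:R - h (- n.+1%:R))%:E @[n --> \oo] --> 0%E.
  apply/fine_cvgP; split; first exact: nearW.
  apply/norm_cvg0P; apply: (@squeeze_cvgr _ _ _ _ (cst 0) (fun n => 2 * n.+1%:R^-1)).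
  - apply: nearW => n /=; rewrite normr_ge0 /=.
    have gn y : 1 <= y -> g y <= y^-1.
      move=> y1; rewrite /g expRN lef_pV2 ?posrE ?expR_gt0//; last exact: lt_le_trans y1.
      by apply: le_trans (expR_ge1Dx _); have := sqr_ge0 (y - 1); nra.
    have hn y : `|h y| <= g y.
      by rewrite /h normrM (gtr0_norm (g_gt0 y)) ler_piMl ?sin_max// ltW.
    rewrite mulr_natl mulr2n; apply: le_trans (ler_normB _ _) _; apply: lerD.
      by apply: le_trans (hn _) (gn _ _); rewrite ler1n.
    have gN y : g (- y) = g y by rewrite /g sqrrN.
    by apply: le_trans (hn _) _; rewrite gN gn// ler1n.
  - exact: cvg_cst.
  - rewrite -[X in _ --> X](mulr0 2); apply: cvgMl_tmp; exact: cvg_harmonic.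
have hKE : (fun n => \int[mu]_(x in K n) (h' x)%:E)%E =
    (fun n => (h n.+1%:R - h (- n.+1%:R))%:E) by apply/funext.
rewrite hKE in c1; rewrite /Rintegral.
by rewrite (cvg_unique _ c1 c0).
Qed.

(** Differentiating under the integral sign and integrating by parts,
    [F c] solves [y' = - t y]. *)
Let F_E c t : F c t = F c 0 * g t.
Proof.
pose k s := F c s * expR (s ^+ 2 / 2).
have dk (s : R) : is_derive s 1 k 0.
  rewrite /k; have dF := is_derive_F c s; apply: is_derive_eq.
  by rewrite by_parts /GRing.scale /=; field.
have := is_derive_0_is_cst t 0 dk.
rewrite /k expr0n mul0r expR0 mulr1 /g expRN => <-.
by rewrite mulfK// gt_eqF// expR_gt0.
Qed.

Lemma ge0_normal_prob_integral (f : R -> \bar R) : measurable_fun setT f ->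
  (forall x, 0 <= f x)%E ->
  (\int[normal_prob 0 1]_x f x = \int[mu]_x (f x * (normal_pdf 0 1 x)%:E))%E.
Proof.
move=> mf f0; have dom := @normal_prob_dominates R 0 1.
rewrite -(Radon_Nikodym_SigmaFinite.change_of_variables dom)//.
apply: ae_eq_integral => //.
- apply: emeasurable_funM => //.
  exact: measurable_int (Radon_Nikodym_SigmaFinite.f_integrable dom).
- apply: emeasurable_funM => //; apply/measurable_EFinP.
  exact: measurable_normal_pdf.
- apply: ae_eqe_mul2l => /=; apply: integral_ae_eq => //.
  + exact: Radon_Nikodym_SigmaFinite.f_integrable.
  + by apply/measurable_EFinP; exact: measurable_normal_pdf.
  + by move=> E _ mE; rewrite -Radon_Nikodym_SigmaFinite.f_integral.
Qed.

Lemma normal_prob_integral (M : R) (f : R -> R) : measurable_fun setT f ->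
  (forall x, `|f x| <= M) ->
  \int[normal_prob 0 1]_x f x = \int[mu]_x (f x * normal_pdf 0 1 x).
Proof.
move=> mf fM; have dom := @normal_prob_dominates R 0 1.
have i1 := @bounded_integrable _ _ _ (normal_prob 0 1) M f mf fM.
rewrite /Rintegral -(Radon_Nikodym_change_of_variables dom measurableT i1).
congr fine; under [RHS]eq_integral do rewrite EFinM.
apply: ae_eq_integral => //.
- by apply: emeasurable_funM => //; exact/measurable_EFinP.
- apply: emeasurable_funM; first exact/measurable_EFinP.
  by apply/measurable_EFinP; exact: measurable_normal_pdf.
- apply: ae_eqe_mul2l => /=; apply: integral_ae_eq => //.
  + exact: Radon_Nikodym_integrable.
  + by apply/measurable_EFinP; exact: measurable_normal_pdf.
  + by move=> E _ mE; rewrite -Radon_Nikodym_integral.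
Qed.

Lemma normal_cf t : real_cf (normal_prob 0 1) ( *%R t) (expR (- (t ^+ 2 / 2))).
Proof.
have k1 : @normal_peak R 1 * F 0 0 = 1.
  have /(congr1 fine) /= E1 := @integral_normal_pdf R 0 1.
  rewrite -[RHS]E1 /F -RintegralZl//.
  by apply: eq_Rintegral => x _; rewrite mul0r addr0 cos0 mul1r g_pdf.
have E c : \int[normal_prob 0 1]_x cos (t * x + c) = @normal_peak R 1 * F c t.
  rewrite (@normal_prob_integral 1); last 2 first.
  - exact: mcos.
  - by move=> x; exact: cos_max.
  rewrite /F -RintegralZl//.
  by apply: eq_Rintegral => x _; rewrite g_pdf mulrCA.
split.
  have := E 0; under eq_Rintegral do rewrite addr0.
  by move=> ->; rewrite F_E mulrA k1 mul1r.
have := E (- (pi / 2)); under eq_Rintegral do rewrite cosBpihalf.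
move=> ->; rewrite F_E (_ : F _ 0 = 0) ?mul0r ?mulr0//.
rewrite /F /Rintegral integral0_eq// => x _.
by rewrite mul0r add0r cosN cos_pihalf mul0r.
Qed.

End gaussian_cf.

(** * Convergent series of independent processes *)

Section almost_sure_limit.
Context d (Om : measurableType d) (R : realType) (P : probability Om R).

Lemma cvg_small_increments (u : R^nat) n :
  (forall k, (n <= k)%N -> `|u k.+1 - u k| <= 2^-1 ^+ k) -> cvgn u.
Proof.
move=> un; pose v k := u (k + n)%N.
suff : cvgn v by move=> /cvg_ex[l vl]; apply/cvg_ex; exists l; rewrite -(cvg_shiftn n).
have : cvgn (series (telescope v)).
  apply: normed_cvg.
  apply: (@series_le_cvg _ _ (geometric 1 2^-1)) => /=.
  - by move=> k; exact: normr_ge0.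
  - by move=> k; rewrite geometric_ge0// invr_ge0.
  - move=> k; rewrite mul1r; apply: (le_trans (un (k + n)%N (leq_addl _ _))).
    rewrite exprD ler_piMr ?exprn_ge0 ?invr_ge0//.
    by rewrite exprn_ile1 ?invr_ge0// invf_le1// ler1n.
  - by apply: is_cvg_geometric_series; rewrite ger0_norm ?invr_ge0// invf_lt1// ltr1n.
rewrite telescopeK => /cvg_ex[l vl]; apply/cvg_ex; exists (l + v 0%N) => /=.
have H := @cvgD _ R^o _ _ _ _ _ _ _ vl (cvg_cst (v 0%N)).
rewrite [X in X @ _ --> _](_ : _ = v) in H ; first exact: H.
by apply/funext => k; rewrite !fctE /= subrK.
Qed.

(** By Borel-Cantelli, almost surely all but finitely many increments are
    dominated by a geometric series. *)
Lemma ae_limit (Y : nat -> Om -> R) : (forall k, measurable_fun setT (Y k)) ->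
  (forall k, (P [set w | (2^-1 ^+ k <= `|Y k.+1 w - Y k w|)%R] <= (2^-1 ^+ k)%:E)%E) ->
  exists2 J : Om -> R, measurable_fun setT J & {ae P, forall w, Y k w @[k --> \oo] --> J w}.
Proof.
move=> mY PY; pose A k := [set w | 2^-1 ^+ k <= `|Y k.+1 w - Y k w|].
have mA k : measurable (A k).
  rewrite (_ : A k = (fun w => `|Y k.+1 w - Y k w|) @^-1` `[2^-1 ^+ k, +oo[%classic).
    have mD : measurable_fun setT (fun w => `|Y k.+1 w - Y k w|).
      by apply: measurableT_comp => //; exact: (measurable_funB (mY _) (mY _)).
    have := mD measurableT _ (measurable_itv `[2^-1 ^+ k, +oo[).
    by rewrite setTI.
  by apply/seteqP; split => w /=; rewrite in_itv /= andbT.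
have PA0 : P (lim_sup_set A) = 0%E.
  apply: lim_sup_set_cvg0 => //.
  apply: (@le_lt_trans _ _ (\sum_(k <oo) (2^-1 ^+ k)%:E)%E).
    by apply: lee_nneseries => [k *|k *]; [exact: measure_ge0|exact: PY].
  rewrite (_ : (\sum_(k <oo) (2^-1 ^+ k)%:E = (2 / 2 ^+ 0)%:E)%E) ?ltry//.
  apply/cvg_lim => //; have H := @cvg_geometric_eseries_half R 2 0.
  rewrite [X in X @ _](_ : _ = eseries (fun k => (2 / (2 ^ (k + 1))%:R)%:E))//.
  apply/funext => n; apply: eq_bigr => k _; congr EFin.
  by rewrite addn1 natrX exprS invfM mulrA divff// mul1r exprVn.
(* An upper limit is measurable everywhere and agrees with the limit where it
   exists. *)
exists (fun w => fine (limn_esup (fun k => (Y k w)%:E))).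
  apply: measurableT_comp => //; apply: measurable_fun_limn_esup => k.
  exact/measurable_EFinP.
exists (lim_sup_set A); split => //.
  by apply: bigcapT_measurable => n; apply: bigcup_measurable => k _; exact: mA.
move=> w /= nw; apply: contrapT => wA; apply: nw.
have [n nA] : exists n, forall k, (n <= k)%N -> ~ A k w.
  apply: contrapT => h; apply: wA => n _; apply: contrapT => h'; apply: h.
  by exists n => k nk Akw; apply: h'; exists k.
have /cvg_ex[l Yl] : cvgn (Y ^~ w).
  apply: (@cvg_small_increments _ n) => k nk; apply/ltW.
  by rewrite ltNge; apply/negP; exact: nA.
have Yl' : (Y k w)%:E @[k --> \oo] --> l%:E.
  by apply/fine_cvgP; split; [exact: nearW|].
by have [_ ->] := cvg_limn_einf_sup Yl'.
Qed.

End almost_sure_limit.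

Section trigonometric_bounds.
Variable R : realType.
Implicit Types a b x : R.

Lemma cos_dist a b : `|cos a - cos b| <= 2 * `|sin ((a - b) / 2)|.
Proof.
set u := (a + b) / 2; set v := (a - b) / 2.
have -> : a = u + v by rewrite /u /v; field.
have -> : b = u - v by rewrite /u /v; field.
rewrite cosD cosB (_ : _ - _ = - (2 * (sin u * sin v))); last by ring.
by rewrite normrN !normrM ger0_norm// ler_pM2l// ler_piMl// sin_max.
Qed.

Lemma sin_dist a b : `|sin a - sin b| <= 2 * `|sin ((a - b) / 2)|.
Proof.
set u := (a + b) / 2; set v := (a - b) / 2.
have -> : a = u + v by rewrite /u /v; field.
have -> : b = u - v by rewrite /u /v; field.
rewrite sinD sinB (_ : _ - _ = 2 * (cos u * sin v)); last by ring.
by rewrite !normrM ger0_norm// ler_pM2l// ler_piMl// cos_max.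
Qed.

Lemma norm_sin_sum I (r : seq I) (x : I -> R) :
  `|sin (\sum_(i <- r) x i)| <= \sum_(i <- r) `|sin (x i)|.
Proof.
elim: r => [|i r IH]; first by rewrite !big_nil sin0 normr0.
rewrite !big_cons sinD; apply: le_trans (ler_normD _ _) _; apply: lerD.
  by rewrite normrM ler_piMr// cos_max.
by rewrite normrM; apply: le_trans IH; rewrite ler_piMl// cos_max.
Qed.

(** The inequality between arithmetic and geometric means for
    [1 - cos x = 2 sin (x / 2) ^ 2]; it bounds a first moment by [1 - cos], whose
    expectation is given by a characteristic function. *)
Lemma sin_half_bound (eta : R) x : 0 < eta ->
  2 * `|sin (x / 2)| <= eta + (1 - cos x) / (2 * eta).
Proof.
move=> e0; have -> : 1 - cos x = 2 * `|sin (x / 2)| ^+ 2.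
  have x2 : x = (x / 2) *+ 2 by rewrite -mulr_natr divfK.
  by rewrite real_normK ?num_real// {1}x2 cos_mulr2n cos2sin2; ring.
set s := `|_|; rewrite -(ler_pM2r e0).
have -> : (eta + 2 * s ^+ 2 / (2 * eta)) * eta = eta ^+ 2 + s ^+ 2.
  by field; rewrite gt_eqF.
by have := sqr_ge0 (eta - s); nra.
Qed.

End trigonometric_bounds.

Lemma Rintegral_fubini d1 d2 (T1 : measurableType d1) (T2 : measurableType d2)
    (R : realType) (P : probability T1 R) (Q : probability T2 R) (M : R)
    (F : T1 * T2 -> R) : measurable_fun setT F -> (forall z, `|F z| <= M) ->
  \int[P]_x \int[Q]_y F (x, y) = \int[Q]_y \int[P]_x F (x, y).
Proof.
move=> mF FM; rewrite /Rintegral; congr fine.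
have iF : (P \x Q)%E.-integrable setT (EFin \o F).
  exact: (@bounded_integrable _ _ R _ M).
have := Fubini iF.
rewrite /fubini_F /fubini_G => FE.
transitivity (\int[P]_x \int[Q]_y (F (x, y))%:E)%E.
  apply: eq_integral => x _; apply/esym; apply: (@integralE_bounded _ _ _ Q M) => //.
  exact: (measurable_fun_pair2 x mF).
apply: etrans FE _; apply: eq_integral => y _.
apply: (@integralE_bounded _ _ _ P M) => //.
exact: (measurable_fun_pair1 y mF).
Qed.

Lemma Rintegral_sum d (T : measurableType d) (R : realType)
    (P : {measure set T -> \bar R}) (D : set T) (I : Type) (r : seq I)
    (u : I -> T -> R) : measurable D ->
  (forall i, P.-integrable D (EFin \o u i)) ->
  \int[P]_(x in D) (\sum_(i <- r) u i x) = \sum_(i <- r) \int[P]_(x in D) u i x.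
Proof.
move=> mD iu; rewrite /Rintegral; under eq_integral do rewrite -sumEFin.
rewrite integral_sum//.
by rewrite sum_fine// => i _; exact: (integrable_fin_num mD (iu i)).
Qed.

Section realizable_series.
Context d (Om : measurableType d) (R : realType) (P : probability Om R).
Variable cut : Om -> Om * Om.
Hypothesis mcut : measurable_fun setT cut.
Hypothesis Pcut : forall A B, measurable A -> measurable B ->
  P (cut @^-1` (A `*` B)) = (P A * P B)%E.
Variables (V : set (R -> R)) (I_ : nat -> (R -> R) -> Om -> R).
Variables (psi_ : nat -> (R -> R) -> R) (psi : (R -> R) -> R).
Hypothesis VL : forall n (f : 'I_n -> R -> R) theta, (forall j, V (f j)) ->
  V (fun x => \sum_(j < n) theta j * f j x).
Hypothesis mI : forall k f, V f -> measurable_fun setT (I_ k f).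
Hypothesis cfI : forall k n (f : 'I_n -> R -> R) (theta : 'I_n -> R),
  (forall j, V (f j)) ->
  real_cf P (fun w => \sum_(j < n) theta j * I_ k (f j) w)
    (expR (- psi_ k (fun x => \sum_(j < n) theta j * f j x))).
Hypothesis psi_ge0 : forall k f, V f -> 0 <= psi_ k f.
Hypothesis psi_cvg : forall f, V f -> series (psi_^~ f) @ \oo --> psi f.

Let S n f := isum cut n (fun k => I_ k f).
Let ser f n := series (psi_^~ f) n.
Let gam := @normal_prob R 0 1.

Let VZ t f : V f -> V (fun x => t * f x).
Proof.
move=> Vf; have := @VL 1 (fun=> f) (fun=> t) (fun=> Vf).
by under eq_fun do rewrite big_ord1.
Qed.

Let mS n f : V f -> measurable_fun setT (S n f).
Proof. by move=> Vf; apply: measurable_isum => // k; exact: mI. Qed.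

Let ser_le f n m : V f -> (n <= m)%N -> ser f n <= ser f m.
Proof.
move=> Vf; apply: nondecreasing_series => // k _ _; exact: psi_ge0.
Qed.

Let ser_psi f n : V f -> ser f n <= psi f.
Proof.
move=> Vf; rewrite -(cvg_lim _ (psi_cvg Vf))//.
apply: nondecreasing_cvgn_le; last by apply/cvg_ex; eexists; exact: psi_cvg.
by move=> a b; exact: ser_le.
Qed.

(** The increment is the independent sum of the terms of rank between [n] and
    [m], in all coordinates [f j] at the same time. *)
Let inc n m d' (f : 'I_d' -> R -> R) theta : (n <= m)%N -> (forall j, V (f j)) ->
  let g := (fun x => \sum_(j < d') theta j * f j x) in
  real_cf P (fun w => \sum_(j < d') theta j * (S m (f j) w - S n (f j) w))
    (expR (- (ser g m - ser g n))).
Proof.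
move=> nm Vf g.
have -> : (fun w => \sum_(j < d') theta j * (S m (f j) w - S n (f j) w)) =
    isum cut m (fun k => if (k < n)%N then cst 0
      else fun w => \sum_(j < d') theta j * I_ k (f j) w).
  apply/funext => w; under eq_bigr do rewrite isumB//.
  rewrite isum_linear; congr (isum _ _ _ _); apply/funext => k; apply/funext => w'.
  by case: ifP => // _; rewrite big1// => j _; rewrite mulr0.
have -> : expR (- (ser g m - ser g n)) =
    \prod_(k < m) (if (k < n)%N then 1 else expR (- psi_ k g)).
  rewrite /ser /series /=.
  elim: m nm => [|m IH]; first by rewrite leqn0 => /eqP ->; rewrite big_ord0 subrr oppr0 expR0.
  rewrite leq_eqVlt => /orP[/eqP <-|].
    by rewrite subrr oppr0 expR0 big1// => k _; rewrite ltn_ord.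
  rewrite ltnS => nm; rewrite big_nat_recr//= big_ord_recr/= ltnNge nm /= -IH//.
  by rewrite -expRD; congr expR; ring.
apply: (@real_cf_isum _ _ _ P cut mcut Pcut m _
  (fun k => if (k < n)%N then 1 else expR (- psi_ k g))) => k.
  case: ifP => _; first exact: measurable_cst.
  by apply: measurable_sum => j; apply: measurable_funM => //; exact: mI.
by case: ifP => _; [exact: real_cf0|exact: cfI].
Qed.

Let inc1 n m f t : (n <= m)%N -> V f ->
  real_cf P (fun w => t * (S m f w - S n f w))
    (expR (- (ser (fun x => t * f x) m - ser (fun x => t * f x) n))).
Proof.
move=> nm Vf; have := @inc n m 1 (fun=> f) (fun=> t) nm (fun=> Vf).
have E (T : Type) (u : T -> R) : (fun x => \sum_(j < 1) t * u x) = (fun x => t * u x).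
  by apply/funext => x; rewrite big_ord1.
by rewrite /= !E.
Qed.

(** The characteristic function at [t] of the sum of the terms of rank at least
    [n], at [f]. *)
Let tail f n t := expR (- (psi (fun x => t * f x) - ser (fun x => t * f x) n)).

Let tail_cvg f n t : V f ->
  expR (- (ser (fun x => t * f x) m - ser (fun x => t * f x) n)) @[m --> \oo]
  --> tail f n t.
Proof.
move=> Vf; apply: continuous_cvg; first exact: continuous_expR.
by apply: (@cvgN _ R^o); apply: (@cvgB _ R^o); [exact: psi_cvg (VZ t Vf)|exact: cvg_cst].
Qed.

Let tail_cvg1 f t : V f -> tail f n t @[n --> \oo] --> (1 : R).
Proof.
move=> Vf; rewrite -(@expR0 R) -(@oppr0 R) -(subrr (psi (fun x => t * f x))).
apply: continuous_cvg; first exact: continuous_expR.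
by apply: (@cvgN _ R^o); apply: (@cvgB _ R^o); [exact: cvg_cst|exact: psi_cvg (VZ t Vf)].
Qed.

Let tail01 f n t : V f -> 0 <= tail f n t <= 1.
Proof.
move=> Vf; rewrite expR_ge0 -expR0 ler_expR oppr_le0 subr_ge0 /=.
exact: ser_psi (VZ t Vf).
Qed.

(** Measurability in [t] comes from expressing [tail] as a limit of
    expectations. *)
Let mtail f n : V f -> measurable_fun setT (tail f n).
Proof.
move=> Vf.
have mA (m : nat) : measurable_fun setT
  (fun t : R => expR (- (ser (fun x => t * f x) (n + m) - ser (fun x => t * f x) n))).
  have -> : (fun t : R => expR (- (ser (fun x => t * f x) (n + m) - ser (fun x => t * f x) n)))
    = (fun t => \int[P]_w cos (t * (S (n + m) f w - S n f w))).
    by apply/funext => t; rewrite (@inc1 _ _ f t (leq_addr m n) Vf).1.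
  apply: measurableT_comp => //.
  apply: (@measurable_fubini_F _ _ _ _ R gam P
    (fun z => (cos (z.1 * (S (n + m) f z.2 - S n f z.2)))%:E)).
  apply: (@bounded_integrable _ _ R (gam \x P)%E 1); last first.
    by move=> z; exact: cos_max.
  apply: (measurableT_comp (@measurable_cos R)).
  apply: measurable_funM; first exact: (@measurable_fst _ _ (measurableTypeR R) Om).
  apply: measurable_funB; apply: (measurableT_comp _ measurable_snd);
    exact: mS.
apply: measurable_fun_cvg mA _ => t _; have := @tail_cvg f n t Vf.
rewrite -(cvg_shiftn n) => H; apply: cvg_trans H.
by apply: near_eq_cvg; apply: nearW => m /=; rewrite addnC.
Qed.

(** Averaging [cos (t D)] over a standard normal [t] gives [exp (- D^2 / 2)];
    exchange the two expectations, and compare the characteristic function of the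
    increment with the smaller one of the whole tail. *)
Let gauss_increment n m f : (n <= m)%N -> V f ->
  \int[P]_w (1 - expR (- ((S m f w - S n f w) ^+ 2 / 2))) <=
  1 - \int[gam]_t tail f n t.
Proof.
move=> nm Vf; set D := fun w => S m f w - S n f w.
have mD : measurable_fun setT D by apply: measurable_funB; exact: mS.
have mE : measurable_fun setT (fun w => expR (- (D w ^+ 2 / 2))).
  apply: measurableT_comp => //; apply: measurable_funN.
  by apply: measurable_funM => //; exact: measurable_funX.
have E01 w : `|expR (- (D w ^+ 2 / 2))| <= 1.
  rewrite ger0_norm ?expR_ge0// -expR0 ler_expR oppr_le0.
  by rewrite mulr_ge0 ?sqr_ge0.
rewrite RintegralB//; last 2 first.
- exact: finite_measure_integrable_cst.
- exact: (@bounded_integrable _ _ R P 1).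
rewrite Rintegral_cstP lerD2l lerN2.
have mF : measurable_fun setT (fun z : Om * measurableTypeR R => cos (D z.1 * z.2)).
  apply: (measurableT_comp (@measurable_cos R)).
  apply: measurable_funM; first exact: measurableT_comp mD measurable_fst.
  exact: (@measurable_snd _ _ Om (measurableTypeR R)).
have -> : \int[P]_w expR (- (D w ^+ 2 / 2)) = \int[P]_w \int[gam]_t cos (D w * t).
  by apply: eq_Rintegral => w _; rewrite (normal_cf (D w)).1.
rewrite (@Rintegral_fubini _ _ _ _ R P gam 1 (fun z => cos (D z.1 * z.2)))//; last first.
  by move=> z; exact: cos_max.
have H t : \int[P]_w cos (D w * t) =
    expR (- (ser (fun x => t * f x) m - ser (fun x => t * f x) n)).
  rewrite -(@inc1 n m f t nm Vf).1; apply: eq_Rintegral => w _.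
  by rewrite mulrC.
apply: le_Rintegral => //.
- apply: (@bounded_integrable _ _ R gam 1); first exact: mtail.
  by move=> t; have /andP[? ?] := tail01 n t Vf; rewrite ger0_norm.
- apply: (@bounded_integrable _ _ R gam 1).
    apply: measurableT_comp => //.
    apply: (@measurable_fubini_G _ _ _ _ R P gam
      (fun z => (cos (D z.1 * z.2))%:E)).
    by apply: (@bounded_integrable _ _ R (P \x gam)%E 1) => // z; exact: cos_max.
  by move=> t; rewrite H ger0_norm ?expR_ge0// -expR0 ler_expR oppr_le0 subr_ge0 ser_le//; exact: VZ.
- move=> t _; rewrite H ler_expR lerN2 lerD2r.
  exact: ser_psi (VZ t Vf).
Qed.

Let tail_integral f : V f -> \int[gam]_t tail f n t @[n --> \oo] --> (1 : R).
Proof.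
move=> Vf; rewrite -[X in _ --> X](Rintegral_cstP gam).
apply: (@Rdominated_convergence _ _ R gam 1).
- by move=> n; exact: mtail.
- exact: measurable_cst.
- by move=> n t; have /andP[? ?] := tail01 n t Vf; rewrite ger0_norm.
- by apply: aeW => t; exact: tail_cvg1.
Qed.

(** A subsequence of the partial sums satisfies the hypothesis of [ae_limit]: by
    [gauss_increment] and the Markov inequality applied to
    [1 - exp (- D^2 / 2)]. *)
Let exists_limit f : V f -> exists2 J : Om -> R, measurable_fun setT J &
  forall n t, \int[P]_w cos (t * (J w - S n f w)) = tail f n t.
Proof.
(* The value of [1 - exp (- D^2 / 2)] at [D = 2 ^ (- k)]. *)
move=> Vf; pose q k : R := 1 - expR (- ((2^-1 ^+ k) ^+ 2 / 2)).
have q0 k : 0 < q k.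
  by rewrite subr_gt0 -expR0 ltr_expR oppr_lt0 divr_gt0// !exprn_gt0 ?invr_gt0.
have /choice[N NP] : forall k, exists N, forall n, (N <= n)%N ->
    1 - \int[gam]_t tail f n t <= 2^-1 ^+ k * q k.
  move=> k; have e0 : 0 < 2^-1 ^+ k * q k by rewrite mulr_gt0// exprn_gt0// invr_gt0.
  have /cvgrPdist_le/(_ _ e0)[N _ NP] := tail_integral Vf.
  by exists N => n /NP /=; apply: le_trans; exact: ler_norm.
(* The subsequence: strictly increasing, with [N k <= phi k]. *)
pose phi k := (\sum_(i < k.+1) (N i).+1)%N.
have phiS k : phi k.+1 = (phi k + (N k.+1).+1)%N by rewrite /phi big_ord_recr.
have Nphi k : (N k <= phi k)%N.
  by rewrite /phi big_ord_recr/= (leq_trans (leqnSn _))// leq_addl.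
have kphi k : (k <= phi k)%N.
  elim: k => // k IH; rewrite phiS addnS ltnS; exact: leq_trans IH (leq_addr _ _).
have [J mJ cJ] : exists2 J : Om -> R, measurable_fun setT J &
    {ae P, forall w, S (phi k) f w @[k --> \oo] --> J w}.
  apply: ae_limit => [k|k]; first exact: mS.
  set A := [set w | _].
  have mD : measurable_fun setT (fun w => S (phi k.+1) f w - S (phi k) f w).
    by apply: measurable_funB; exact: mS.
  have mA : measurable A.
    rewrite (_ : A = (fun w => `|S (phi k.+1) f w - S (phi k) f w|) @^-1`
        `[2^-1 ^+ k, +oo[%classic).
      have mnD := measurableT_comp (@normr_measurable R setT) mD.
      by have := mnD measurableT _ (measurable_itv `[2^-1 ^+ k, +oo[); rewrite setTI.
    by apply/seteqP; split => w /=; rewrite in_itv /= andbT.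
  rewrite -(fineK (fin_num_measure P _ mA)) lee_fin -(ler_pM2r (q0 k)).
  apply: le_trans (NP _ _ (Nphi k)).
  have phik : (phi k <= phi k.+1)%N by rewrite phiS leq_addr.
  apply: le_trans (gauss_increment phik Vf).
  have -> : fine (P A) * q k = \int[P]_w (q k * \1_A w).
    rewrite RintegralZl//; last first.
      apply: (@bounded_integrable _ _ R P 1) => // w.
      by rewrite ger0_norm// indicE; case: (_ \in _).
    by rewrite /Rintegral integral_indic// setIT mulrC.
  apply: le_Rintegral => //.
  - apply: (@bounded_integrable _ _ R P (q k)).
      exact: measurable_funM.
    by move=> w; rewrite indicE normrM (gtr0_norm (q0 k)); case: (_ \in _);
      rewrite ?normr1 ?normr0 ?mulr1 ?mulr0// ltW.
  - apply: (@bounded_integrable _ _ R P 1).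
      apply: measurable_funB => //; apply: measurableT_comp => //.
      apply: measurable_funN; apply: measurable_funM => //.
      exact: measurable_funX.
    move=> w; rewrite ger0_norm.
      by rewrite lerBlDr lerDl expR_ge0.
    by rewrite subr_ge0 -expR0 ler_expR oppr_le0 mulr_ge0 ?sqr_ge0.
  - move=> w _; rewrite indicE; have [wA|wA] := boolP (w \in A).
      rewrite mulr1 lerD2l lerN2 ler_expR lerN2 ler_pM2r ?invr_gt0//.
      rewrite -(real_normK (num_real (_ - _))) ler_pXn2r ?nnegrE ?exprn_ge0 ?invr_ge0//.
      by move: wA; rewrite inE.
    by rewrite mulr0 subr_ge0 -expR0 ler_expR oppr_le0 mulr_ge0 ?sqr_ge0.
exists J => // n t.
have c1 : \int[P]_w cos (t * (S (phi k) f w - S n f w)) @[k --> \oo] -->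
    \int[P]_w cos (t * (J w - S n f w)).
  apply: (@Rdominated_convergence _ _ R P 1).
  - move=> k; apply: (measurableT_comp (@measurable_cos R)).
    by apply: measurable_funM => //; apply: measurable_funB; exact: mS.
  - apply: (measurableT_comp (@measurable_cos R)).
    by apply: measurable_funM => //; apply: measurable_funB => //; exact: mS.
  - by move=> k w; exact: cos_max.
  - move: cJ; apply: filterS => w cw.
    apply: continuous_cvg; first exact: continuous_cos.
    apply: (@cvgMl_tmp R _ _ _ (fun k => S (phi k) f w - S n f w)).
    by apply: (@cvgB _ R^o) => //; exact: cvg_cst.
have phioo : phi @ \oo --> \oo.
  apply/cvgnyPge => m; exists m => // k /= mk; exact: leq_trans (kphi k).
have c2 := cvg_comp _ _ phioo (@tail_cvg f n t Vf).
have c3 : \int[P]_w cos (t * (S (phi k) f w - S n f w)) @[k --> \oo] --> tail f n t.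
  apply: cvg_trans c2; apply: near_eq_cvg; exists n => // k /= nk.
  by rewrite (@inc1 n (phi k) f t (leq_trans nk (kphi k)) Vf).1.
by rewrite (cvg_unique _ c1 c3).
Qed.

(** The limits [I f] are taken along subsequences that depend on [f]. Still, the
    full sequence of [\sum_j theta_j S n (f j)] converges to
    [\sum_j theta_j I (f j)] in the sense that the expectations of cosines and sines
    converge: their differences are bounded by a multiple of
    [|sin ((a - b) / 2)|], which is subadditive in [a - b], and the expectation
    of [1 - cos (theta_j (I (f j) - S n (f j)))] tends to 0. *)
Lemma realizable_series : realizable P V psi.
Proof.
have /choice[I IP] : forall f, exists J : Om -> R, V f -> measurable_fun setT J /\
    forall n t, \int[P]_w cos (t * (J w - S n f w)) = tail f n t.
  move=> f; have [Vf|nVf] := pselect (V f); last by exists (cst 0).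
  by have [J mJ HJ] := exists_limit Vf; exists J.
exists I => [f /IP[]//|N f theta Vf].
set g := (fun x : R => _); have Vg : V g by exact: VL.
pose A w := \sum_(j < N) theta j * I (f j) w.
pose B n w := \sum_(j < N) theta j * S n (f j) w.
have mA : measurable_fun setT A.
  by apply: measurable_sum => j; apply: measurable_funM => //; have [] := IP _ (Vf j).
have mB n : measurable_fun setT (B n).
  by apply: measurable_sum => j; apply: measurable_funM => //; exact: mS.
have cB n : real_cf P (B n) (expR (- ser g n)).
  have := @inc 0 n N f theta (leq0n n) Vf.
  rewrite /= /ser {2}/series /= big_geq// subr0.
  rewrite (_ : (fun w => \sum_(j < N) theta j * (S n (f j) w - S 0 (f j) w)) = B n)//.
  by apply/funext => w; apply: eq_bigr => j _; rewrite /S /= subr0.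
have key (T : R -> R) : (forall x, `|T x| <= 1) -> measurable_fun setT T ->
    (forall a b, `|T a - T b| <= 2 * `|sin ((a - b) / 2)|) ->
    \int[P]_w T (B n w) @[n --> \oo] --> \int[P]_w T (A w).
  move=> T1 mT dT; apply/cvgrPdist_le => e e0.
  (* With this [eta] the limit of the bound is [N * eta < e]. *)
  pose eta := e / (2 * N.+1%:R).
  have eta0 : 0 < eta by rewrite divr_gt0// mulr_gt0.
  pose bd n := \sum_(j < N) (eta + (1 - tail (f j) n (theta j)) / (2 * eta)).
  have bdn n : `|\int[P]_w T (A w) - \int[P]_w T (B n w)| <= bd n.
    pose u j w := eta + (1 - cos (theta j * (I (f j) w - S n (f j) w))) / (2 * eta).
    have mu j : measurable_fun setT (u j).
      apply: measurable_funD => //; apply: measurable_funM => //.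
      apply: measurable_funB => //; apply: (measurableT_comp (@measurable_cos R)).
      apply: measurable_funM => //; apply: measurable_funB; last exact: mS.
      by have [] := IP _ (Vf j).
    have iu j : P.-integrable setT (EFin \o u j).
      apply: (@bounded_integrable _ _ R P (eta + 2 / (2 * eta))) => // w.
      have c1 := cos_le1 (theta j * (I (f j) w - S n (f j) w)).
      have c2 := cos_geN1 (theta j * (I (f j) w - S n (f j) w)).
      rewrite ger0_norm; last first.
        by rewrite addr_ge0 ?(ltW eta0)// divr_ge0 ?subr_ge0// mulr_ge0// ltW.
      by rewrite lerD2l ler_pM2r ?invr_gt0 ?mulr_gt0//; lra.
    have -> : bd n = \int[P]_w \sum_(j < N) u j w.
      rewrite Rintegral_sum//; apply: eq_bigr => j _.
      have mc : measurable_fun setT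
          (fun w => theta j * (I (f j) w - S n (f j) w)).
        apply: measurable_funM => //; apply: measurable_funB; last exact: mS.
        by have [] := IP _ (Vf j).
      have ic := integrable_cos P mc.
      rewrite /u RintegralD//; last 2 first.
      - exact: finite_measure_integrable_cst.
      - have := integrableB measurableT (iu j)
          (finite_measure_integrable_cst P eta measurableT).
        by apply: eq_integrable => // w _; rewrite /u /= -EFinB addrAC subrr add0r.
      rewrite Rintegral_cstP; congr (_ + _).
      rewrite RintegralZr//; last first.
        exact: (integrableB measurableT
          (finite_measure_integrable_cst P 1 measurableT) ic).
      rewrite RintegralB//; last exact: finite_measure_integrable_cst.
      by rewrite Rintegral_cstP (IP _ (Vf j)).2.
    have iT (X : Om -> R) : measurable_fun setT X ->
        P.-integrable setT (EFin \o (fun w => T (X w))).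
      move=> mX; apply: (@bounded_integrable _ _ R P 1) => //.
      exact: measurableT_comp mT mX.
    rewrite -RintegralB//; [|exact: iT|exact: iT].
    have iTB : P.-integrable setT (EFin \o (fun w => T (A w) - T (B n w))).
      exact: (integrableB measurableT (iT _ mA) (iT _ (mB n))).
    apply: le_trans (le_normr_Rintegral _ iTB) _ => //.
    apply: le_Rintegral => //.
    - exact: (integrable_norm iTB).
    - have := integrable_sum measurableT (index_enum _) (fun j (_ : xpredT j) => iu j).
      by apply: eq_integrable => // w _; rewrite /= sumEFin.
    move=> w _; apply: le_trans (dT _ _) _.
    have -> : (A w - B n w) / 2 =
        \sum_(j < N) (theta j * (I (f j) w - S n (f j) w)) / 2.
      rewrite /A /B -sumrB mulr_suml; apply: eq_bigr => j _.
      by rewrite mulrBr.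
    apply: le_trans (ler_wpM2l _ (norm_sin_sum _ _)) _ => //.
    rewrite mulr_sumr; apply: ler_sum => j _.
    exact: sin_half_bound.
  have bdc : bd n @[n --> \oo] --> \sum_(j < N) (eta + (1 - 1) / (2 * eta)).
    apply: cvg_big => [|j _]; first exact: (@add_continuous R).
    apply: (@cvgD _ R^o); first exact: cvg_cst.
    apply: cvgMr_tmp; apply: (@cvgB _ R^o); first exact: cvg_cst.
    exact: tail_cvg1.
  have lim_lt : \sum_(j < N) (eta + (1 - 1) / (2 * eta)) < e.
    rewrite (eq_bigr (fun=> eta)) => [|j _]; last by rewrite subrr mul0r addr0.
    rewrite sumr_const card_ord -mulr_natr /eta mulrAC ltr_pdivrMr ?mulr_gt0//.
    by rewrite ltr_pM2l// -natrM ltr_nat; lia.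
  have [m _ Hm] := cvgr_lt _ bdc _ lim_lt; exists m => // n mn /=.
  exact: le_trans (bdn n) (ltW (Hm n mn)).
split.
  have c1 := key _ (@cos_max R) (@measurable_cos R) (@cos_dist R).
  have c2 : \int[P]_w cos (B n w) @[n --> \oo] --> expR (- psi g).
    under eq_cvg do rewrite (cB _).1.
    apply: continuous_cvg; first exact: continuous_expR.
    by apply: (@cvgN _ R^o); exact: psi_cvg.
  by rewrite (cvg_unique _ c1 c2).
have c1 := key _ (@sin_max R) (@measurable_sin R) (@sin_dist R).
have c2 : \int[P]_w sin (B n w) @[n --> \oo] --> (0 : R).
  by under eq_cvg do rewrite (cB _).2; exact: cvg_cst.
by rewrite (cvg_unique _ c1 c2).
Qed.

End realizable_series.

Section realizable_sum.
Context d (Om : measurableType d) (R : realType) (P : probability Om R).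
Variable cut : Om -> Om * Om.
Hypothesis mcut : measurable_fun setT cut.
Hypothesis Pcut : forall A B, measurable A -> measurable B ->
  P (cut @^-1` (A `*` B)) = (P A * P B)%E.

Lemma realizable_sum (V : set (R -> R)) (psi_ : nat -> (R -> R) -> R)
    (psi : (R -> R) -> R) :
  (forall n (f : 'I_n -> R -> R) theta, (forall j, V (f j)) ->
    V (fun x => \sum_(j < n) theta j * f j x)) ->
  (forall k, realizable P V (psi_ k)) ->
  (forall k f, V f -> 0 <= psi_ k f) ->
  (forall f, V f -> series (psi_^~ f) @ \oo --> psi f) ->
  realizable P V psi.
Proof.
move=> VL rk psi0 psic.
have /choice[I IP] : forall k, exists I : (R -> R) -> Om -> R,
    (forall f, V f -> measurable_fun setT (I f)) /\
    forall n (f : 'I_n -> R -> R) (theta : 'I_n -> R), (forall j, V (f j)) ->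
      real_cf P (fun w => \sum_(j < n) theta j * I (f j) w)
        (expR (- psi_ k (fun x => \sum_(j < n) theta j * f j x))).
  by move=> k; have [I ? ?] := rk k; exists I.
apply: (@realizable_series _ _ _ P cut mcut Pcut V I psi_ psi) => // k.
- exact: (IP k).1.
- exact: (IP k).2.
Qed.

End realizable_sum.

(** * Dyadic cells of the line *)

Section dyadic_cells.
Variable R : realType.
Local Notation mu := (@lebesgue_measure R).
Implicit Types x y : R.

Definition dfloor n x : int := Num.floor (2 ^+ n * x).

Lemma dfloorS n x :
  dfloor n.+1 x = 2 * dfloor n x + (odd `|dfloor n.+1 x|%N)%:Z.
Proof.
rewrite /dfloor exprS -mulrA; set y := 2 ^+ n * x; set m := Num.floor y.
have /andP[my ym] := floor_itv y; rewrite -/m in my ym.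
have [y1|y1] := ltP (2 * y) (2 * m + 1)%:~R.
  have -> : Num.floor (2 * y) = 2 * m.
    apply: floor_def; rewrite y1 andbT intrM ler_pM2l//.
  by rewrite abszM oddM addr0.
have -> : Num.floor (2 * y) = 2 * m + 1.
  apply: floor_def; rewrite y1 /= (_ : 2 * m + 1 + 1 = 2 * (m + 1)); last by ring.
  by rewrite intrM ltr_pM2l.
have -> // : odd `|(2 * m + 1)%R|%N = true.
by lia.
Qed.

(** A numbering of the dyadic intervals of length [2 ^- n] of the whole line by
    natural numbers, such that the halves of interval [k] are intervals [2 k] and
    [2 k + 1] of the next level. A number that codes no interval gets an empty
    cell. *)
Fixpoint code n x : nat :=
  if n is n'.+1 then (code n' x).*2 + odd `|dfloor n x|%N
  else choice.pickle (dfloor 0 x).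

Lemma codeP n x y : (code n x = code n y) <-> (dfloor n x = dfloor n y).
Proof.
elim: n => [|n IH].
  by split => [/(pcan_inj (@choice.pickleK _))//|e]; rewrite /= e.
change ((code n x).*2 + odd `|dfloor n.+1 x|%N =
  (code n y).*2 + odd `|dfloor n.+1 y|%N <-> dfloor n.+1 x = dfloor n.+1 y)%N.
split => E.
  have o : odd `|dfloor n.+1 x|%N = odd `|dfloor n.+1 y|%N.
    by move/(congr1 odd) : E; rewrite !oddD !odd_double !oddb.
  move: E; rewrite o => /addIn /double_inj /IH e.
  by rewrite dfloorS e o -dfloorS.
rewrite E; congr (_ + _)%N; congr _.*2; apply/IH.
have := dfloorS n x; rewrite E {1}(dfloorS n y) => /addIr.
by move=> /(@mulfI _ 2)->.
Qed.

Definition cell n k : set R := [set x | code n x = k].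

Lemma cell_itv n x : cell n (code n x) =
  `[(dfloor n x)%:~R / 2 ^+ n, (dfloor n x + 1)%:~R / 2 ^+ n[%classic.
Proof.
apply/seteqP; split => y; rewrite /cell /= in_itv /=
  ler_pdivrMr ?ltr_pdivlMr ?exprn_gt0// ![y * _]mulrC.
  by move=> /codeP <-; exact: floor_itv.
by move=> /floor_def e; apply/codeP.
Qed.

Lemma cell0 n k : (exists x, code n x = k) \/ cell n k = set0.
Proof.
have [?|h] := pselect (exists x, code n x = k); [by left|right].
by apply/seteqP; split => // x xk; apply: h; exists x.
Qed.

Lemma measurable_cell n k : measurable (cell n k).
Proof.
by have [[x <-]|->//] := cell0 n k; rewrite cell_itv; exact: measurable_itv.
Qed.

Lemma lebesgue_cell n x : mu (cell n (code n x)) = (2 ^- n)%:E.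
Proof.
rewrite cell_itv lebesgue_measure_itv /= lte_fin ltr_pM2r ?invr_gt0 ?exprn_gt0//.
by rewrite ltr_int ltrDl ltr01 -EFinB -mulrBl intrD addrAC subrr add0r mul1r.
Qed.

Lemma lebesgue_cell_le n k : (mu (cell n k) <= (2 ^- n)%:E)%E.
Proof.
have [[x <-]|->] := cell0 n k; first by rewrite lebesgue_cell.
by rewrite measure0 lee_fin invr_ge0 exprn_ge0.
Qed.

Lemma trivIset_cell n : trivIset setT (cell n).
Proof. by move=> i j _ _ [x [/= <- <-]]. Qed.

Lemma bigcup_cell n : \bigcup_k cell n k = setT.
Proof. by apply/seteqP; split => // x _; exists (code n x). Qed.

Lemma cell_split n k : cell n k = cell n.+1 k.*2 `|` cell n.+1 k.*2.+1.
Proof.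
apply/seteqP; split => x; rewrite /cell /= -/(dfloor _ _).
  move=> ->; case: odd; [right|left]; lia.
by case => /eqP; case: odd => /eqP; lia.
Qed.

(** The cell of [x] is contained in the ball of radius [2 * 2 ^- n] about [x],
    and its length is a quarter of that of the ball. *)
Lemma nice_cell x : nicely_shrinking x (fun n => cell n (code n x)).
Proof.
split; first by move=> n; exact: measurable_cell.
have r0 n : 0 < 2 * 2^-1 ^+ n :> R by rewrite mulr_gt0// exprn_gt0// invr_gt0.
exists (4, fun n => PosNum (r0 n)); split => //=.
- rewrite -[X in _ --> X](mulr0 2); apply: cvgMl_tmp; apply: cvg_expr.
  by rewrite ger0_norm ?invr_ge0// invf_lt1// ltr1n.
- move=> n y; rewrite cell_itv /ball /= in_itv /= => /andP[y1 y2].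
  have /andP[x1 x2] : (dfloor n x)%:~R / 2 ^+ n <= x < (dfloor n x + 1)%:~R / 2 ^+ n.
    rewrite ler_pdivrMr ?ltr_pdivlMr ?exprn_gt0// ![x * _]mulrC.
    exact: floor_itv.
  move: x1 x2 y1 y2; rewrite intrD mulrDl mul1r -exprVn => x1 x2 y1 y2.
  have := exprn_gt0 n (_ : 0 < 2^-1 :> R); rewrite invr_gt0 => /(_ (ltr0Sn _ _)) e0.
  by rewrite ltr_norml; apply/andP; split; lra.
- move=> n; rewrite lebesgue_cell lebesgue_measure_ball; last exact: ltW.
  by rewrite -EFinM lee_fin exprVn; lra.
Qed.

End dyadic_cells.

(** * White noise *)

Lemma nneseries_pair (R : realType) (u : (\bar R)^nat) :
  (forall k, 0 <= u k)%E ->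
  (\sum_(k <oo) u k = \sum_(k <oo) (u k.*2 + u k.*2.+1))%E.
Proof.
move=> u0; apply/esym/cvg_lim => //.
have cu : (\sum_(0 <= k < n) u k)%E @[n --> \oo] --> (\sum_(k <oo) u k)%E.
  by apply: is_cvg_nneseries => n _ _.
have doo : double @ \oo --> \oo.
  by apply/cvgnyPge => m; exists m => // k /= mk; rewrite -addnn (leq_trans mk)// leq_addr.
have := cvg_comp _ _ doo cu; rewrite /comp /=.
suff E n : (\sum_(0 <= k < n.*2) u k = \sum_(0 <= k < n) (u k.*2 + u k.*2.+1))%E.
  by under eq_cvg do rewrite E.
elim: n => [|n IH]; first by rewrite !big_geq.
by rewrite doubleS !big_nat_recr//= IH addeA.
Qed.

Section square_integrable.
Variable R : realType.
Local Notation mu := (@lebesgue_measure R).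

Definition L2 : set (R -> R) := [set f : R -> R | measurable_fun setT f /\
  (\int[mu]_x (f x ^+ 2)%:E < +oo)%E].

Lemma L2_linear n (f : 'I_n -> R -> R) theta : (forall j, L2 (f j)) ->
  L2 (fun x => \sum_(j < n) theta j * f j x).
Proof.
elim: n f theta => [|n IH] f theta Vf.
  split; first by under eq_fun do rewrite big_ord0; exact: measurable_cst.
  rewrite integral0_eq ?ltry// => x _.
  by rewrite big_ord0 expr0n.
have [mf0 If0] := Vf ord0.
have [mg Ig] := IH _ (theta \o lift ord0) (fun j => Vf (lift ord0 j)).
under eq_fun do rewrite big_ord_recl; set g : R -> R := fun x => _ in mg Ig *.
have sq0 (h : R -> R) x : (0 <= (h x ^+ 2)%:E)%E by rewrite lee_fin sqr_ge0.
have c0 : (0 <= (2 * theta ord0 ^+ 2)%:E)%E by rewrite lee_fin mulr_ge0 ?sqr_ge0.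
have c2 : (0 <= 2%:E :> \bar R)%E by rewrite lee_fin.
have m0 : measurable_fun setT (fun x => (f ord0 x ^+ 2)%:E).
  by apply/measurable_EFinP; exact: measurable_funX.
have m1 : measurable_fun setT (fun x => (g x ^+ 2)%:E).
  by apply/measurable_EFinP; exact: measurable_funX.
have mh : measurable_fun setT (fun x => theta ord0 * f ord0 x + g x).
  by apply: measurable_funD mg; exact: measurable_funM.
split; first exact: mh.
apply: (@le_lt_trans _ _ (\int[mu]_x ((2 * theta ord0 ^+ 2)%:E * (f ord0 x ^+ 2)%:E
   + 2%:E * (g x ^+ 2)%:E))%E).
  apply: ge0_le_integral => //.
  - by apply/measurable_EFinP; exact: measurable_funX mh.
  - by apply: emeasurable_funD; exact: measurable_funeM.
  - move=> x _; rewrite -!EFinM -EFinD lee_fin -/(g x).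
    by have := sqr_ge0 (theta ord0 * f ord0 x - g x); nra.
rewrite ge0_integralD//; last 4 first.
- by move=> x _; rewrite mule_ge0.
- exact: measurable_funeM.
- by move=> x _; rewrite mule_ge0.
- exact: measurable_funeM.
rewrite !ge0_integralZl//.
by apply: lte_add_pinfty; apply: lte_mul_pinfty.
Qed.

Section cell_integrals.
Variable f : R -> R.
Hypothesis Vf : L2 f.
Let mf : measurable_fun setT f := Vf.1.

Definition cellint n k : R := \int[mu]_(x in cell n k) f x.

Let sq_ge0 x : (0 <= (f x ^+ 2)%:E)%E. Proof. by rewrite lee_fin sqr_ge0. Qed.

Let msq : measurable_fun setT (fun x => (f x ^+ 2)%:E).
Proof. by apply/measurable_EFinP; exact: measurable_funX. Qed.

Let cell_sq n k : (\int[mu]_(x in cell n k) (f x ^+ 2)%:E < +oo)%E.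
Proof.
apply: le_lt_trans Vf.2; apply: ge0_subset_integral => //.
exact: measurable_cell.
Qed.

Let cell_lty n k : (mu (cell n k) < +oo)%E.
Proof. by rewrite (le_lt_trans (lebesgue_cell_le _ _ _))// ltry. Qed.

Lemma cell_integrable n k : mu.-integrable (cell n k) (EFin \o f).
Proof.
have mc : measurable (cell n k : set (measurableTypeR R)) := @measurable_cell R n k.
apply/integrableP; split; first by apply/measurable_EFinP; exact: measurable_funTS.
apply: (@le_lt_trans _ _ (\int[mu]_(x in cell n k) (1%:E + (f x ^+ 2)%:E))%E).
  apply: ge0_le_integral => //.
  - apply: measurableT_comp => //; apply/measurable_EFinP; exact: measurable_funTS.
  - by apply: emeasurable_funD => //; exact: measurable_funTS.
  - move=> x _; rewrite /= -EFinD lee_fin -(real_normK (num_real (f x))).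
    by have := sqr_ge0 (`|f x| - 1); nra.
rewrite ge0_integralD//; last exact: measurable_funTS.
by rewrite integral_cst// mul1e; apply: lte_add_pinfty; [exact: cell_lty|exact: cell_sq].
Qed.

Let cell_sq_integrable n k :
  mu.-integrable (cell n k) (EFin \o (fun x => f x ^+ 2)).
Proof.
apply/integrableP; split; first exact: measurable_funTS msq.
by under eq_integral do rewrite /= ger0_norm ?sqr_ge0//; exact: cell_sq.
Qed.

Lemma cellint_split n k : cellint n k = cellint n.+1 k.*2 + cellint n.+1 k.*2.+1.
Proof.
rewrite /cellint cell_split Rintegral_setU//.
- exact: measurable_cell.
- exact: measurable_cell.
- by rewrite -cell_split; exact: cell_integrable.
- apply/disj_setPS => x [/= <- /eqP]; lia.
Qed.

(** The squared norm of the conditional expectation of [f] on the cells of level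
    [n], which equals [2 ^+ n * cellint n k] on cell [k]. *)
Definition energy n : \bar R := (\sum_(k <oo) (2 ^+ n * cellint n k ^+ 2)%:E)%E.

(** Parallelogram identity on each cell; the added terms are squares of Haar
    coefficients. *)
Lemma energyS n : energy n.+1 = (energy n + \sum_(k <oo)
  (2 ^+ n * (cellint n.+1 k.*2 - cellint n.+1 k.*2.+1) ^+ 2)%:E)%E.
Proof.
rewrite /energy nneseries_pair; last first.
  by move=> k; rewrite lee_fin mulr_ge0 ?sqr_ge0 ?exprn_ge0.
rewrite -nneseriesD.
- apply: eq_eseriesr => k _; rewrite (cellint_split n) -!EFinD; congr EFin.
  by rewrite exprS; ring.
- by move=> k _; rewrite lee_fin mulr_ge0 ?sqr_ge0 ?exprn_ge0.
- by move=> k _; rewrite lee_fin mulr_ge0 ?sqr_ge0 ?exprn_ge0.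
Qed.

Let cellint_cell0 n k : @cell R n k = set0 -> cellint n k = 0.
Proof. by rewrite /cellint => ->; exact: Rintegral_set0. Qed.

(** The Cauchy-Schwarz inequality on a cell, from [(f - c)^2 >= 0] with [c] the
    mean of [f]. *)
Lemma cellint_le n k :
  ((2 ^+ n * cellint n k ^+ 2)%:E <= \int[mu]_(x in cell n k) (f x ^+ 2)%:E)%E.
Proof.
have mc : measurable (cell n k : set (measurableTypeR R)) := @measurable_cell R n k.
have [[x0 x0k]|c0] := @cell0 R n k; last first.
  by rewrite cellint_cell0// expr0n mulr0; exact: integral_ge0.
rewrite -(fineK (integrable_fin_num mc (cell_sq_integrable n k))) lee_fin.
set c := 2 ^+ n * cellint n k.
have icst : mu.-integrable (cell n k) (EFin \o cst (c ^+ 2)).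
  apply: measurable_bounded_integrable => //; first exact: cell_lty.
  exact: bounded_cst.
have i2 := integrableZl mc (2 * c) (cell_integrable n k).
have : \int[mu]_(x in cell n k) (2 * c * f x - c ^+ 2) <=
    \int[mu]_(x in cell n k) (f x ^+ 2).
  apply: le_Rintegral => //.
  - exact: (integrableB mc i2 icst).
  - by move=> x _; have := sqr_ge0 (f x - c); nra.
apply: le_trans; rewrite RintegralB// RintegralZl//; last exact: cell_integrable.
have mk : mu (cell n k) = (2 ^- n)%:E by rewrite -x0k lebesgue_cell.
rewrite Rintegral_cst// [X in c ^+ 2 * fine X]mk /= -/(cellint n k) /c.
rewrite le_eqVlt; apply/orP; left; apply/eqP.
by field; rewrite expf_neq0.
Qed.

Lemma energy_le n : (energy n <= \int[mu]_x (f x ^+ 2)%:E)%E.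
Proof.
have <- := bigcup_cell R n; rewrite ge0_integral_bigcup//.
- apply: lee_nneseries => k *; last exact: cellint_le.
  by rewrite lee_fin mulr_ge0 ?sqr_ge0 ?exprn_ge0.
- by move=> k; exact: measurable_cell.
- exact: measurable_funTS.
- exact: trivIset_cell.
Qed.

Let step n (x : R) : R := 2 ^+ n * cellint n (code n x).

Lemma measurable_code n : measurable_fun setT (@code R n).
Proof.
move=> _ A _; rewrite setTI.
rewrite (_ : _ @^-1` A = \bigcup_(k in A) cell n k).
  by apply: bigcup_measurable => k _; exact: measurable_cell.
apply/seteqP; split => [x Ax|x [k + xk]]; first by exists (code n x).
by move: xk; rewrite /cell /= => ->.
Qed.

Let mstep n : measurable_fun setT (step n).
Proof.
apply: measurable_funM => //.
by apply: (measurableT_comp (f := cellint n)) => //; exact: measurable_code.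
Qed.

Let mstep2 n : measurable_fun setT (fun x => (step n x ^+ 2)%:E).
Proof. by apply/measurable_EFinP; exact: measurable_funX. Qed.

Let energy_step n : (\int[mu]_x (step n x ^+ 2)%:E = energy n)%E.
Proof.
have <- := bigcup_cell R n; rewrite ge0_integral_bigcup//; first last.
- exact: trivIset_cell.
- by move=> x _; rewrite lee_fin sqr_ge0.
- exact: (measurable_funTS (mstep2 n)).
- by move=> k; exact: measurable_cell.
apply: eq_eseriesr => k _.
have [[x0 x0k]|c0] := @cell0 R n k; last first.
  by rewrite cellint_cell0// expr0n mulr0 c0 integral_set0.
rewrite (eq_integral (cst ((2 ^+ n * cellint n k) ^+ 2)%:E)); last first.
  by move=> x; rewrite inE /cell /step /= => ->.
have mk : mu (cell n k) = (2 ^- n)%:E by rewrite -x0k lebesgue_cell.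
rewrite integral_cst; last exact: measurable_cell.
rewrite [X in (_ * X)%E]mk -EFinM; congr EFin.
by field; rewrite expf_neq0.
Qed.

(** The energies increase and stay below [\int f^2]. For the converse bound,
    the conditional expectations converge to [f] almost everywhere by Lebesgue
    differentiation, and the Fatou lemma applies. *)
Lemma energy_cvg : energy n @[n --> \oo] --> (\int[mu]_x (f x ^+ 2)%:E)%E.
Proof.
have nd : nondecreasing_seq energy.
  apply/nondecreasing_seqP => n; rewrite energyS leeDl//.
  by apply: nneseries_ge0 => k _ _; rewrite lee_fin mulr_ge0 ?sqr_ge0 ?exprn_ge0.
have cE := ereal_nondecreasing_cvgn nd.
suff -> : (\int[mu]_x (f x ^+ 2)%:E = ereal_sup (range energy))%E by [].
apply/eqP; rewrite eq_le; apply/andP; split; last first.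
  by apply: ge_ereal_sup => _ [n _ <-]; exact: energy_le.
have [<- _] := cvg_limn_einf_sup cE.
have -> : energy = (fun n => \int[mu]_x (step n x ^+ 2)%:E)%E.
  by apply/funext => n; rewrite energy_step.
apply: le_trans (fatou _ _ _ _) => //; last by move=> n x _; rewrite lee_fin sqr_ge0.
rewrite le_eqVlt; apply/orP; left; apply/eqP.
have locf : locally_integrable setT f.
  split => //; first exact: openT.
  move=> K _ cK; have mK := compact_measurable cK.
  have Koo := compact_finite_measure cK.
  apply: (@le_lt_trans _ _ (\int[mu]_(x in K) (1%:E + (f x ^+ 2)%:E))%E).
    apply: ge0_le_integral => //.
    - apply/measurable_EFinP; apply: measurableT_comp => //; exact: measurable_funTS.
      - by apply: emeasurable_funD => //; exact: measurable_funTS.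
    - move=> x _; rewrite /= -EFinD lee_fin -(real_normK (num_real (f x))).
      by have := sqr_ge0 (`|f x| - 1); nra.
  rewrite ge0_integralD//; last exact: measurable_funTS.
  rewrite integral_cst// mul1e; apply: lte_add_pinfty => //.
  by apply: le_lt_trans Vf.2; exact: ge0_subset_integral.
apply: ge0_ae_eq_integral => //.
- rewrite /limn_einf; apply: measurableT_comp => //.
  apply: measurable_fun_limn_esup => n.
  by apply: measurableT_comp => //; exact: mstep2.
- move=> x _; rewrite limn_einf_lim; apply: lime_ge; first exact: is_cvg_einfs.
  apply: nearW => n; apply: le_ereal_inf_tmp => _ [m _ <-].
  by rewrite lee_fin sqr_ge0.
have [N [mN N0 NP]] := lebesgue_differentiation locf.
exists N; split => // x /= nx; apply: NP => /= fx; apply: nx => _.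
have H := nice_lebesgue_differentiation (@nice_cell R) locf fx.
have sx : step n x @[n --> \oo] --> f x.
  suff : (step n x)%:E @[n --> \oo] --> (f x)%:E by move/fine_cvg.
  apply: cvg_trans H; apply: near_eq_cvg; apply: nearW => n /=.
  rewrite lebesgue_cell inver invr_eq0 expf_eq0 pnatr_eq0 andbF invrK /step /cellint EFinM fineK//.
  by apply: integrable_fin_num; [exact: measurable_cell|exact: cell_integrable].
have sx2 : (step n x ^+ 2)%:E @[n --> \oo] --> (f x ^+ 2)%:E.
  apply/fine_cvgP; split; first exact: nearW.
  by apply: (cvg_comp _ (fun y : R => y ^+ 2)) sx _; exact: exprn_continuous.
by rewrite (cvg_limn_einf_sup sx2).1.
Qed.

End cell_integrals.
End square_integrable.

Lemma series_cvg_fine (R : realType) (u : R^nat) (v : \bar R) :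
  (forall k, 0 <= u k) -> (\sum_(k <oo) (u k)%:E = v)%E -> (v < +oo)%E ->
  series u @ \oo --> fine v.
Proof.
move=> u0 uv voo.
have v0 : (0 <= v)%E by rewrite -uv; apply: nneseries_ge0 => k *; rewrite lee_fin.
have cu : (\sum_(0 <= k < n) (u k)%:E)%E @[n --> \oo] --> v.
  by rewrite -uv; apply: is_cvg_nneseries => n _ _; rewrite lee_fin.
have -> : series u = (fun n => fine (\sum_(0 <= k < n) (u k)%:E)%E).
  by apply/funext => n; rewrite sumEFin.
by apply: fine_cvg; rewrite fineK// ge0_fin_numE.
Qed.

Section white_noise.
Context d (Om : measurableType d) (R : realType) (P : probability Om R).
Variable cut : Om -> Om * Om.
Hypothesis mcut : measurable_fun setT cut.
Hypothesis Pcut : forall A B, measurable A -> measurable B ->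
  P (cut @^-1` (A `*` B)) = (P A * P B)%E.
Variable G : Om -> R.
Hypothesis mG : measurable_fun setT G.
Hypothesis cfG : forall t : R, real_cf P (fun w => t * G w) (expR (- (t ^+ 2 / 2))).
Local Notation mu := (@lebesgue_measure R).

Lemma cellint_linear m k n (f : 'I_n -> R -> R) theta : (forall j, @L2 R (f j)) ->
  cellint (fun x => \sum_(j < n) theta j * f j x) m k =
  \sum_(j < n) theta j * cellint (f j) m k.
Proof.
move=> Vf; rewrite /cellint.
have mc : measurable (cell m k : set (measurableTypeR R)) by exact: measurable_cell.
rewrite Rintegral_sum//.
  by apply: eq_bigr => j _; rewrite RintegralZl//; exact: cell_integrable.
move=> j; exact: (integrableZl mc (theta j) (cell_integrable (Vf j) m k)).
Qed.

(** Up to sign, the coefficients of [f] in the Haar system: level 0 has the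
    indicators of the unit cells, level [n.+1] the differences of the two halves
    of the cells of level [n]. *)
Let haar m k (f : R -> R) : R :=
  if m is n.+1 then Num.sqrt (2 ^+ n) * (cellint f m k.*2 - cellint f m k.*2.+1)
  else cellint f 0 k.

Let level m (f : R -> R) : \bar R := (\sum_(k <oo) (haar m k f ^+ 2)%:E)%E.

Let level0 f : level 0 f = energy f 0.
Proof. by apply: eq_eseriesr => k _; rewrite expr0 mul1r. Qed.

Let levelS n f : L2 f -> energy f n.+1 = (energy f n + level n.+1 f)%E.
Proof.
move=> Vf; rewrite energyS//; congr (_ + _)%E; apply: eq_eseriesr => k _.
by rewrite /haar exprMn sqr_sqrtr ?exprn_ge0.
Qed.

Let level_ge0 m f : (0 <= level m f)%E.
Proof. by apply: nneseries_ge0 => k *; rewrite lee_fin sqr_ge0. Qed.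

Let energy_ge0 n (f : R -> R) : (0 <= energy f n)%E.
Proof.
by apply: nneseries_ge0 => k *; rewrite lee_fin mulr_ge0 ?sqr_ge0 ?exprn_ge0.
Qed.

Let energy_fin n (f : R -> R) : L2 f -> energy f n \is a fin_num.
Proof.
by move=> Vf; rewrite ge0_fin_numE//; apply: le_lt_trans (energy_le Vf n) Vf.2.
Qed.

Let level_lty m f : L2 f -> (level m f < +oo)%E.
Proof.
move=> Vf; case: m => [|n].
  by rewrite level0 -ge0_fin_numE//; exact: energy_fin.
apply: (@le_lt_trans _ _ (energy f n.+1)).
  by rewrite levelS// leeDr.
by rewrite -ge0_fin_numE//; exact: energy_fin.
Qed.

(** Parseval for the Haar system: [\int f^2] is the sum over the levels, then over
    the cells, of squares of linear forms. *)
Lemma realizable_white_noise :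
  realizable P (@L2 R) (fun f => fine (\int[mu]_x (f x ^+ 2)%:E)%E).
Proof.
apply: (realizable_sum mcut Pcut (psi_ := fun m f => fine (level m f))).
- exact: L2_linear.
- move=> m; apply: (realizable_sum mcut Pcut (psi_ := fun k f => haar m k f ^+ 2)).
  + exact: L2_linear.
  + move=> k; apply: (realizable_gauss mG cfG) => n f theta Vf.
    rewrite /haar; case: m => [|m]; first exact: cellint_linear.
    rewrite !cellint_linear// -sumrB mulr_sumr.
    by apply: eq_bigr => j _; rewrite -mulrBr mulrCA.
  + by move=> k f _; rewrite sqr_ge0.
  + by move=> f Vf; apply: series_cvg_fine => // [k|]; [exact: sqr_ge0|exact: level_lty].
- by move=> m f _; exact: fine_ge0.
- move=> f Vf.
  have cE : fine (energy f n) @[n --> \oo] --> fine (\int[mu]_x (f x ^+ 2)%:E)%E.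
    apply: fine_cvg; rewrite fineK; first exact: energy_cvg.
    rewrite ge0_fin_numE; first exact: Vf.2.
    by apply: integral_ge0 => x _; rewrite lee_fin sqr_ge0.
  rewrite -(cvg_shiftS); under eq_cvg => n.
    rewrite /series /= (_ : \sum_(0 <= m < n.+1) fine (level m f) = fine (energy f n)).
      over.
    elim: n => [|n IH]; first by rewrite big_nat1 level0.
    rewrite big_nat_recr//= IH levelS// fineD//; first exact: energy_fin.
    by rewrite ge0_fin_numE//; exact: level_lty.
  exact: cE.
Qed.

End white_noise.

(** * Powers as mixtures *)

Lemma measurable_powR2 d (T : measurableType d) (R : realType) (u v : T -> R) :
  measurable_fun setT u -> measurable_fun setT v ->
  measurable_fun setT (fun z => u z `^ v z).
Proof.
move=> mu mv; rewrite /powR; apply: measurable_fun_ifT.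
- by apply: measurable_fun_eqr => //; exact: measurable_cst.
- have -> : (fun z => (v z == 0)%:R : R) =
      (fun b : bool => b%:R) \o (fun z => v z == 0) by [].
  apply: measurableT_comp => //.
  by apply: measurable_fun_eqr => //; exact: measurable_cst.
- apply: measurableT_comp => //; apply: measurable_funM => //.
  by apply: measurableT_comp => //; exact: measurable_ln.
Qed.

Lemma sqr_powR (R : realType) (z e : R) : (z `^ e) ^+ 2 = z `^ (e * 2).
Proof. by rewrite powRrM powR_mulrn// powR_ge0. Qed.

Section affine_change_of_variables.
Variable R : realType.
Local Notation mu := (@lebesgue_measure R).
Variables (c b : R) (c0 : 0 < c).

Let aff (x : measurableTypeR R) : measurableTypeR R := c * x + b.

Let maff : measurable_fun setT aff.
Proof. by apply: measurable_funD => //; exact: mulrl_measurable. Qed.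

Let nu : {measure set (measurableTypeR R) -> \bar R} :=
  mscale (NngNum (ltW c0))
   (measure_function_pushforward__canonical__measure_function_Measure mu maff).

Let nuE A : measurable A -> mu A = nu A.
Proof.
move=> mA; apply: lebesgue_measure_unique => // _ [[x y] _ <-] /=.
rewrite /mscale /= /pushforward.
pose J := `](x - b) / c, (y - b) / c]%classic.
have -> : aff @^-1` `]x, y] = J.
  apply/seteqP; split => z; rewrite /J /aff /= !in_itv /=
    ltr_pdivrMr// ler_pdivlMr// [z * c]mulrC ltrBlDr lerBrDr//.
rewrite [RHS](_ : _ = (c%:E * mu J)%E)// /J.
rewrite !lebesgue_measure_itv /= !lte_fin ltr_pM2r ?invr_gt0// ltrD2r.
case: ifP => _; last by rewrite mule0.
by rewrite -!EFinD -EFinM; congr EFin; field; rewrite gt_eqF.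
Qed.

(** Lebesgue measure and its rescaled image under the affine map agree on
    intervals, hence on all Borel sets. *)
Lemma ge0_integral_affine (F : R -> \bar R) : measurable_fun setT F ->
  (forall x, 0 <= F x)%E ->
  (\int[mu]_x F (c * x + b)%R = (c^-1)%:E * \int[mu]_x F x)%E.
Proof.
move=> mF F0.
have -> : (\int[mu]_x F x = \int[nu]_x F x)%E.
  by apply: eq_measure_integral => A mA _; exact: nuE.
rewrite ge0_integral_mscale// ge0_integral_pushforward//=.
by rewrite muleA -EFinM mulVf ?gt_eqF// mul1e.
Qed.

End affine_change_of_variables.

Section stable_constant.
Variable R : realType.
Local Notation mu := (@lebesgue_measure R).

Lemma powR_cvgy0 (e : R) : 0 < e -> x `^ (- e) @[x --> +oo] --> (0 : R).
Proof.
move=> e0; apply/cvgrPdist_le => eps eps0.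
exists (eps `^ (- e^-1)); split; first exact: num_real.
move=> x xM; have x0 : 0 < x by rewrite (le_lt_trans _ xM)// powR_ge0.
rewrite sub0r normrN ger0_norm ?powR_ge0// powRN.
rewrite invf_ple ?posrE ?powR_gt0//.
have -> : eps^-1 = (eps `^ (- e^-1)) `^ e.
  by rewrite -powRrM mulNr mulVf ?gt_eqF// powR_inv1// ltW.
by apply: ge0_ler_powR; rewrite ?nnegrE ?powR_ge0 ?ltW.
Qed.

Lemma integral_powR (s : R) : 1 < s ->
  (\int[mu]_(w in `[1%R, +oo[) (w `^ (- s))%:E = ((s - 1)^-1)%:E)%E.
Proof.
move=> s1; have s0 : 0 < s - 1 by rewrite subr_gt0.
pose F (x : R) := - ((s - 1)^-1) * x `^ (- (s - 1)).
have dF (x : R) : 0 < x -> is_derive x 1 F (x `^ (- s)).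
  move=> x0; have H := is_derive1_powR (- (s - 1)) x0.
  rewrite /F; apply: is_derive_eq.
  rewrite /GRing.scale /= (_ : - (s - 1) - 1 = - s); last by ring.
  by field; rewrite gt_eqF.
have dp (x : R) : 0 < x -> derivable (fun w => w `^ (- s)) x 1.
  by move=> x0; have H := is_derive1_powR (- s) x0; exact: ex_derive.
have -> : ((s - 1)^-1)%:E = (0%:E - (F 1)%:E)%E :> \bar R.
  by rewrite /F powR1 mulr1 EFinN oppeK add0e.
apply: ge0_continuous_FTC2y.
- by move=> x _; exact: powR_ge0.
- apply: derivable_within_continuous => x; rewrite in_itv /= andbT => x1.
  by apply: dp; exact: lt_le_trans x1.
- rewrite -[X in _ --> X](mulr0 (- (s - 1)^-1)); apply: cvgMl_tmp.
  exact: powR_cvgy0.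
- move=> x x1; have H := dF x (lt_trans ltr01 x1); exact: ex_derive.
- apply: cvg_at_right_filter; apply: differentiable_continuous.
  by apply/derivable1_diffP; have H := dF 1 ltr01; exact: ex_derive.
- move=> x; rewrite in_itv /= andbT => x1; rewrite derive1E.
  by have H := dF x (lt_trans ltr01 x1); exact: derive_val.
Qed.

(** With [s = w ^ (- 2 / b)] this is the integral of [1 - exp (- s)] for the Levy
    measure [b / 2 * s ^ (- b / 2 - 1) ds] of a positive stable law of index
    [b / 2]. *)
Definition stable_const (b : R) : \bar R :=
  (\int[mu]_(w in `]0%R, +oo[) (1 - expR (- (w `^ (- (2 / b)))))%:E)%E.

Lemma expR_decay01 (z : R) : 0 <= z -> 0 <= 1 - expR (- z) <= 1.
Proof.
move=> z0; rewrite subr_ge0 -expR0 ler_expR oppr_le0 z0 /=.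
by rewrite gerBl expR_ge0.
Qed.

Let K (b w : R) := 1 - expR (- (w `^ (- (2 / b)))).

Let mK b : measurable_fun setT (K b).
Proof.
apply: measurable_funB => //; apply: measurableT_comp => //.
apply: measurable_funN; exact: measurable_powR.
Qed.

Let K01 b w : 0 <= K b w <= 1.
Proof. by apply: expR_decay01; exact: powR_ge0. Qed.

(** The integrand is bounded by 1 near 0, and by [w ^ (- 2 / b)], of exponent less
    than [- 1], at infinity. *)
Lemma stable_const_lty b : 0 < b < 2 -> (stable_const b < +oo)%E.
Proof.
move=> /andP[b0 b2].
have s1 : 1 < 2 / b by rewrite ltr_pdivlMr// mul1r.
rewrite /stable_const.
have -> : `]0, +oo[%classic = `]0, 1[%classic `|` `[1, +oo[%classic :> set R.
  apply/seteqP; split => x /=; rewrite !in_itv /= ?andbT.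
    by move=> x0; have [x1|x1] := ltP x 1; [left; rewrite x0|right].
  by case=> [/andP[]//|x1]; exact: lt_le_trans x1.
rewrite ge0_integral_setU//=.
- apply: lte_add_pinfty.
    apply: (@le_lt_trans _ _ (\int[mu]_(w in `]0%R, 1%R[) 1%:E)%E).
      apply: ge0_le_integral => //.
      + by move=> w _; rewrite lee_fin; have /andP[] := K01 b w.
      + by apply/measurable_EFinP; apply: measurable_funTS; exact: mK.
      + by move=> w _; rewrite lee_fin; have /andP[] := K01 b w.
    rewrite integral_cst//= mul1e lebesgue_measure_itv /= lte_fin ltr01.
    by rewrite oppr0 adde0 ltry.
  apply: (@le_lt_trans _ _ (\int[mu]_(w in `[1%R, +oo[) (w `^ (- (2 / b)))%:E)%E).
    apply: ge0_le_integral => //.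
    + by move=> w _; rewrite lee_fin; have /andP[] := K01 b w.
    + by apply/measurable_EFinP; apply: measurable_funTS; exact: mK.
    + apply/measurable_EFinP; apply: measurable_funTS; exact: measurable_powR.
    + by move=> w _; rewrite lee_fin lerBlDr -lerBlDl; have := expR_ge1Dx (- w `^ (- (2 / b))); lra.
  by rewrite integral_powR// ltry.
- by apply/measurable_EFinP; apply: measurable_funTS; exact: mK.
- by move=> w _; rewrite lee_fin; have /andP[] := K01 b w.
- apply/disj_setPS => x [] /=; rewrite !in_itv /= andbT => /andP[_ x1].
  by rewrite leNgt x1.
Qed.

Lemma stable_const_gt0 b : 0 < b -> (0 < stable_const b)%E.
Proof.
move=> b0; apply: (@lt_le_trans _ _ (1 - expR (- 1))%:E).
  by rewrite lte_fin subr_gt0 -expR0 ltr_expR oppr_lt0.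
have -> : (1 - expR (- 1))%:E = (\int[mu]_(w in `]0%R, 1%R]) (1 - expR (- 1))%:E)%E :> \bar R.
  by rewrite integral_cst//= lebesgue_measure_itv /= lte_fin ltr01 oppr0 adde0 mule1.
apply: (@le_trans _ _ (\int[mu]_(w in `]0%R, 1%R]) (K b w)%:E)%E).
  apply: ge0_le_integral => //.
  - by apply/measurable_EFinP; apply: measurable_funTS; exact: mK.
  - move=> w /=; rewrite in_itv /= => /andP[w0 w1].
    rewrite lee_fin lerD2l lerN2 ler_expR lerN2 powRN.
    rewrite invf_ge1 ?powR_gt0//.
    have b2 : 0 <= 2 / b by rewrite divr_ge0 ?ltW.
    by have := ge0_ler_powR b2 (ltW w0) ler01 w1; rewrite powR1.
apply: ge0_subset_integral => //.
- by apply/measurable_EFinP; apply: measurable_funTS; exact: mK.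
- by move=> w _; rewrite lee_fin; have /andP[] := K01 b w.
- by move=> w /=; rewrite !in_itv /= andbT => /andP[].
Qed.

End stable_constant.

Section tiling.
Variable R : realType.
Local Notation mu := (@lebesgue_measure R).

(** The half line is tiled by unit intervals; the endpoints are negligible. *)
Lemma nneseries_unit_translates (F : R -> \bar R) : measurable_fun setT F ->
  (forall x, 0 <= F x)%E ->
  (\sum_(j <oo) \int[mu]_(w in `[0%R, 1%R]) F (j%:R + w)%R =
   \int[mu]_(w in `]0%R, +oo[) F w)%E.
Proof.
move=> mF F0.
rewrite integral_itv_obnd_cbnd; last exact: measurable_funTS.
pose D (j : nat) := `[(j%:R : R), j.+1%:R[%classic.
have DE : `[0%R, +oo[%classic = \bigcup_j D j :> set R.
  apply/seteqP; split => [x /=|x [j _] /=]; rewrite /D /= !in_itv /= ?andbT.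
    move=> x0; exists (Num.truncn x) => //=.
    by rewrite in_itv /= truncn_itv.
  by move=> /andP[jx _]; exact: le_trans jx.
rewrite DE ge0_integral_bigcup//; last 3 first.
- by move=> k; exact: measurable_itv.
- exact: measurable_funTS.
- apply/trivIsetP => i j _ _ ij; apply/seteqP; split => // x [] /=.
  rewrite /D /= !in_itv /= => /andP[ix xi] /andP[jx xj].
  have x0 : 0 <= x by exact: le_trans ix.
  move/negP : ij; apply; apply/eqP.
  by rewrite -(@truncn_def _ x i) ?ix// -(@truncn_def _ x j) ?jx.
apply: eq_eseriesr => j _; rewrite /D.
have -> : (\int[mu]_(w in `[0%R, 1%R]) F (j%:R + w)%R =
           \int[mu]_(w in `[0%R, 1%R[) F (j%:R + w)%R)%E.
  rewrite integral_itv_bndo_bndc//; apply: measurable_funTS.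
  by apply: measurableT_comp => //; exact: measurable_funD.
rewrite [LHS]integral_mkcond [RHS]integral_mkcond.
have H := @ge0_integral_affine R 1 j%:R ltr01 (F \_ `[(j%:R : R), j.+1%:R[).
rewrite invr1 mul1e in H; apply: etrans (H _ _).
- apply: eq_integral => x _; rewrite !patchE mul1r addrC.
  congr (if _ then _ else _); apply/idP/idP; rewrite !inE /= !in_itv /=.
    by rewrite -natr1; lra.
  by rewrite -natr1; lra.
- by apply/(measurable_restrictT _ _).1 => //; exact: measurable_funTS.
- by move=> x; rewrite patchE; case: ifP.
Qed.

(** For [y != 0] the factor [y ^ 2] is absorbed into [w] by the substitution of
    [c * |y| ^ (- b) * w] for [w]. *)
Lemma integral_stable_scaling (b c y : R) : 0 < b < 2 -> 0 < c ->
  (\int[mu]_(w in `]0%R, +oo[)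
     (1 - expR (- (y ^+ 2 * (c * w) `^ (- (2 / b)))))%:E =
   (`|y| `^ b / c)%:E * stable_const b)%E.
Proof.
move=> /andP[b0 b2] c0; have [->|y0] := eqVneq y 0.
  rewrite normr0 powR0 ?gt_eqF// mul0r mul0e integral0_eq// => w _.
  by rewrite expr0n mul0r oppr0 expR0 subrr.
have ny : 0 < `|y| by rewrite normr_gt0.
have yb : 0 < `|y| `^ (- b) by rewrite powR_gt0.
have g0 : 0 < c * `|y| `^ (- b) by rewrite mulr_gt0.
have yE : (`|y| `^ (- b)) `^ (- (2 / b)) = y ^+ 2.
  have e2 : - b * - (2 / b) = 2%:R by field; rewrite gt_eqF.
  by rewrite -powRrM e2 powR_mulrn// real_normK// num_real.
have scale (x : R) : 0 < x ->
    y ^+ 2 * (c * x) `^ (- (2 / b)) = (c * `|y| `^ (- b) * x) `^ (- (2 / b)).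
  move=> x0; have cx0 : 0 <= c * x by rewrite mulr_ge0 ?ltW.
  by rewrite [c * _ * x]mulrAC (powRM _ cx0 (ltW yb)) yE mulrC.
pose F (w : R) := (1 - expR (- (w `^ (- (2 / b)))))%:E.
rewrite /stable_const [LHS]integral_mkcond [in RHS]integral_mkcond.
have -> : `|y| `^ b / c = (c * `|y| `^ (- b) )^-1.
  by rewrite invfM -powRN opprK mulrC.
rewrite -(@ge0_integral_affine R _ 0 g0).
- apply: eq_integral => x _; rewrite !patchE addr0.
  have -> : (c * `|y| `^ (- b) * x \in `]0, +oo[%classic) =
      (x \in `]0, +oo[%classic).
    by apply/idP/idP; rewrite !inE /= !in_itv /= !andbT pmulr_rgt0.
  case: ifPn => //; rewrite inE /= in_itv /= andbT => x0.
  by rewrite scale.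
- apply/(measurable_restrictT _ _).1 => //; apply: measurable_funTS.
  apply/measurable_EFinP; apply: measurable_funB => //; apply: measurableT_comp => //.
  by apply: measurable_funN; exact: measurable_powR.
- move=> x; rewrite patchE; case: ifP => // _.
  by rewrite lee_fin; case/andP: (expR_decay01 (powR_ge0 x (- (2 / b)))).
Qed.

End tiling.

(** * Compound Poisson processes with Gaussian jumps *)

Lemma ge0_integral_law d (T : measurableType d) (R : realType)
    (P : {measure set T -> \bar R}) (X : T -> R)
    (nu : {measure set (measurableTypeR R) -> \bar R}) (f : R -> \bar R) :
  measurable_fun setT X -> (forall A, measurable A -> P (X @^-1` A) = nu A) ->
  measurable_fun setT f -> (forall x, 0 <= f x)%E ->
  (\int[P]_w f (X w) = \int[nu]_x f x)%E.
Proof.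
move=> mX law mf f0.
have mX' : measurable_fun setT (X : T -> measurableTypeR R) by [].
pose Q : {measure set (measurableTypeR R) -> \bar R} :=
  measure_function_pushforward__canonical__measure_function_Measure P mX'.
transitivity (\int[Q]_x f x)%E; first by rewrite [RHS]ge0_integral_pushforward.
by apply: eq_measure_integral => A mA _; exact: law.
Qed.

Lemma measurable_unit_integral (R : realType) (D : R * R -> R) :
  measurable_fun setT D -> (forall z, 0 <= D z) ->
  measurable_fun setT
    (fun x => \int[@lebesgue_measure R]_(w in `[0%R, 1%R]) (D (x, w))%:E)%E.
Proof.
move=> mD D0; pose f (z : R * measurableTypeR R) : \bar R :=
  (if (0 <= z.2) && (z.2 <= 1) then D z else 0)%:E.
have m2 := @measurable_snd _ _ R (measurableTypeR R).
have mf : measurable_fun setT f.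
  apply/measurable_EFinP; apply: measurable_fun_ifT => //.
  by apply: measurable_and; apply: measurable_fun_ler => //; exact: measurable_cst.
have f0 z : (0 <= f z)%E by rewrite lee_fin; case: ifP.
have -> : (fun x => \int[@lebesgue_measure R]_(w in `[0%R, 1%R]) (D (x, w))%:E)%E =
    fubini_F lebesgue_measure f.
  apply/funext => x; rewrite integral_mkcond.
  apply: eq_integral => w _; rewrite patchE /f /=.
  rewrite (_ : (w \in `[0%R, 1%R]%classic) = (0 <= w) && (w <= 1)).
    by case: ifP.
  by apply/idP/idP; rewrite inE /= in_itv.
exact: measurable_fun_fubini_tonelli_F.
Qed.

Section gaussian_mixture.
Context d (Om : measurableType d) (R : realType) (P : probability Om R).
Variable cut : Om -> Om * Om.
Hypothesis mcut : measurable_fun setT cut.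
Hypothesis Pcut : forall A B, measurable A -> measurable B ->
  P (cut @^-1` (A `*` B)) = (P A * P B)%E.
Variables X W G : Om -> R.
Hypothesis mX : measurable_fun setT X.
Hypothesis mW : measurable_fun setT W.
Hypothesis mG : measurable_fun setT G.
Hypothesis lawX : forall A, measurable A -> P (X @^-1` A) = normal_prob 0 1 A.
Hypothesis lawW : forall A, measurable A ->
  P (W @^-1` A) = uniform_prob (@ltr01 R) A.
Hypothesis cfG : forall t : R, real_cf P (fun w => t * G w) (expR (- (t ^+ 2 / 2))).
Local Notation mu := (@lebesgue_measure R).

(** The three sources of randomness are read from independent parts of [w]. The
    factor [sqrt 2] makes [exp (- S^2)] the conditional characteristic
    function. *)
Definition gauss_mixture (S : R * R -> R) (w : Om) : R :=
  Num.sqrt 2 * S (X (cut w).1, W (cut (cut w).2).1) * G (cut (cut w).2).2.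

Definition mixture_cf (S : R * R -> R) : R :=
  \int[P]_u \int[P]_v expR (- (S (X u, W v) ^+ 2)).

Lemma measurable_gauss_mixture S : measurable_fun setT S ->
  measurable_fun setT (gauss_mixture S).
Proof.
move=> mS; have m1 := measurable_cut1 mcut; have m2 := measurable_cut2 mcut.
apply: measurable_funM; last exact: measurableT_comp mG (measurableT_comp m2 m2).
apply: measurable_funM => //; apply: (measurableT_comp mS).
apply/measurable_fun_pairP; split; first exact: measurableT_comp mX m1.
exact: measurableT_comp mW (measurableT_comp m1 m2).
Qed.

(** Fubini: integrate first over the Gaussian variable. *)
Lemma real_cf_gauss_mixture S : measurable_fun setT S ->
  real_cf P (gauss_mixture S) (mixture_cf S).
Proof.
move=> mS; have m1 := measurable_cut1 mcut; have m2 := measurable_cut2 mcut.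
(* [t] is the cosine or the sine, and [c v] the expectation of [t] of a centered
   Gaussian variable of variance [2 v]. *)
have key (t : R -> R) (c : R -> R) : measurable_fun setT t ->
    (forall x, `|t x| <= 1) ->
    (forall s : R, \int[P]_w t (s * G w) = c (s ^+ 2 / 2)) ->
    \int[P]_w t (gauss_mixture S w) =
    \int[P]_u \int[P]_v c (S (X u, W v) ^+ 2).
  move=> mt t1 tc.
  pose Z (z : Om * Om) : R :=
    Num.sqrt 2 * S (X z.1, W (cut z.2).1) * G (cut z.2).2.
  have mZ : measurable_fun setT Z.
    apply: measurable_funM; last first.
      exact: measurableT_comp mG (measurableT_comp m2 measurable_snd).
    apply: measurable_funM => //; apply: (measurableT_comp mS).
    apply/measurable_fun_pairP; split; first exact: measurableT_comp mX measurable_fst.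
    exact: measurableT_comp mW (measurableT_comp m1 measurable_snd).
  rewrite (@Rintegral_cut _ _ _ P cut mcut Pcut 1 (t \o Z))//; last 2 first.
  - exact: measurableT_comp.
  - by move=> z; exact: t1.
  apply: eq_Rintegral => u _ /=.
  pose Y (z : Om * Om) : R := Num.sqrt 2 * S (X u, W z.1) * G z.2.
  have mY : measurable_fun setT Y.
    apply: measurable_funM; last exact: measurableT_comp mG measurable_snd.
    apply: measurable_funM => //; apply: (measurableT_comp mS).
    apply/measurable_fun_pairP; split; first exact: measurable_cst.
    exact: measurableT_comp mW measurable_fst.
  rewrite (@Rintegral_cut _ _ _ P cut mcut Pcut 1 (t \o Y))//; last 2 first.
  - exact: measurableT_comp.
  - by move=> z; exact: t1.
  apply: eq_Rintegral => v _; rewrite /Y /= tc.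
  by rewrite exprMn sqr_sqrtr// mulrC mulKf.
split.
  apply: (key (@cos R) (fun x => expR (- x))) => [|x|s].
  - exact: measurable_cos.
  - exact: cos_max.
  - by case: (cfG s).
rewrite (key (@sin R) (fun=> 0))//.
- by under eq_Rintegral do rewrite Rintegral_cstP; rewrite Rintegral_cstP.
- exact: measurable_sin.
- exact: sin_max.
- by move=> s; case: (cfG s).
Qed.

Lemma mixture_cf01 S : measurable_fun setT S -> 0 <= mixture_cf S <= 1.
Proof.
move=> mS; apply/andP; split.
  by apply: Rintegral_ge0 => u _; apply: Rintegral_ge0 => v _; exact: expR_ge0.
have [<- _] := real_cf_gauss_mixture mS.
apply: le_trans (ler_norm _) _; apply: Rintegral_bound => [|w].
  exact: measurableT_comp (@measurable_cos R) (measurable_gauss_mixture mS).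
exact: cos_max.
Qed.

(** The laws of [X] and [W] turn the expectation into a Lebesgue integral with the
    normal density as weight, over unit length in the second variable. *)
Lemma mixture_exponent S : measurable_fun setT S ->
  ((1 - mixture_cf S)%:E = \int[mu]_x
    ((\int[mu]_(w in `[0%R, 1%R]) (1 - expR (- (S (x, w) ^+ 2)))%:E) *
     (normal_pdf 0 1 x)%:E))%E.
Proof.
move=> mS; pose D (z : R * R) := 1 - expR (- (S z ^+ 2)).
have D01 z : 0 <= D z <= 1 by apply: expR_decay01; exact: sqr_ge0.
have Db z : `|D z| <= 1 by have /andP[D0 D1] := D01 z; rewrite ger0_norm.
have mD : measurable_fun setT D.
  apply: measurable_funB => //; apply: measurableT_comp => //.
  by apply: measurable_funN; exact: measurable_funX.
pose DXW (z : Om * Om) := D (X z.1, W z.2).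
have mDXW : measurable_fun setT DXW.
  apply: (measurableT_comp mD); apply/measurable_fun_pairP; split.
    exact: measurableT_comp mX measurable_fst.
  exact: measurableT_comp mW measurable_snd.
have mDu u : measurable_fun setT (fun v => D (X u, W v)).
  exact: (measurable_fun_pair2 u mDXW).
have mI : measurable_fun setT (fun u => \int[P]_v D (X u, W v)).
  by apply: (@measurable_Rintegral2 _ _ _ P 1 DXW) => // z; exact: Db.
have -> : 1 - mixture_cf S = \int[P]_u \int[P]_v D (X u, W v).
  have mC u : measurable_fun setT (fun v => expR (- (S (X u, W v) ^+ 2))).
    have -> : (fun v => expR (- (S (X u, W v) ^+ 2))) = (fun v => 1 - D (X u, W v)).
      by apply/funext => v; rewrite /D opprB addrCA subrr addr0.
    exact: measurable_funB.
  have C1 u v : `|expR (- (S (X u, W v) ^+ 2))| <= 1.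
    by rewrite ger0_norm ?expR_ge0// -expR0 ler_expR oppr_le0 sqr_ge0.
  have i1 : P.-integrable setT (EFin \o (fun=> 1 : R)).
    by apply: (@bounded_integrable _ _ _ P 1) => // w; rewrite normr1.
  have E u : \int[P]_v expR (- (S (X u, W v) ^+ 2)) =
      1 - \int[P]_v D (X u, W v).
    rewrite -[X in X - _](Rintegral_cstP P) -RintegralB//.
      by apply: eq_Rintegral => v _; rewrite /D opprB addrCA subrr addr0.
    exact: (@bounded_integrable _ _ _ P 1).
  rewrite /mixture_cf; under eq_Rintegral do rewrite E.
  rewrite RintegralB//; first by rewrite Rintegral_cstP opprB addrCA subrr addr0.
  apply: (@bounded_integrable _ _ _ P 1) => // u.
  exact: Rintegral_bound.
rewrite -(@integralE_bounded _ _ _ P 1)//; last first.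
  by move=> u; exact: Rintegral_bound.
have mDe x : measurable_fun setT (fun w => (D (x, w))%:E).
  by apply/measurable_EFinP; exact: (measurable_fun_pair2 x mD).
have D0 x w : (0 <= (D (x, w))%:E)%E.
  by rewrite lee_fin; case/andP: (D01 (x, w)).
have inner x : (\int[P]_v (D (x, W v))%:E =
    \int[mu]_(w in `[0%R, 1%R]) (D (x, w))%:E)%E.
  rewrite (@ge0_integral_law _ _ _ P W (uniform_prob (@ltr01 R))
    (fun w => (D (x, w))%:E))// integral_uniform//.
    by rewrite subr0 invr1 mul1e.
  exact: mDe.
transitivity (\int[P]_u \int[mu]_(w in `[0%R, 1%R]) (D (X u, w))%:E)%E.
  apply: eq_integral => u _; rewrite -inner.
  by rewrite (@integralE_bounded _ _ _ P 1).
pose H x := (\int[mu]_(w in `[0%R, 1%R]) (D (x, w))%:E)%E.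
have mH : measurable_fun setT H.
  by apply: measurable_unit_integral => // z; case/andP: (D01 z).
have H0 x : (0 <= H x)%E by apply: integral_ge0 => w _; exact: D0.
rewrite (@ge0_integral_law _ _ _ P X (normal_prob 0 1) H)//.
by rewrite ge0_normal_prob_integral.
Qed.

End gaussian_mixture.

(** * Functions of finite modular *)

Section finite_modular.
Variable R : realType.
Local Notation mu := (@lebesgue_measure R).
Variable beta : R -> R.
Hypothesis mbeta : measurable_fun setT beta.
Hypothesis beta02 : forall x, 0 < beta x <= 2.

Definition finite_modular : set (R -> R) :=
  [set g : R -> R | measurable_fun setT g /\
           (\int[mu]_x (`|g x| `^ beta x)%:E < +oo)%E].

Lemma measurable_modular_integrand (g : R -> R) : measurable_fun setT g ->
  measurable_fun setT (fun x => (`|g x| `^ beta x)%:E).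
Proof.
move=> mg; apply/measurable_EFinP; apply: measurable_powR2 => //.
exact: measurableT_comp.
Qed.

Lemma finite_modular_le (c : R) (g h : R -> R) : 0 <= c ->
  measurable_fun setT g -> measurable_fun setT h ->
  (forall x, `|h x| `^ beta x <= c * `|g x| `^ beta x) ->
  finite_modular g -> finite_modular h.
Proof.
move=> c0 mg mh hg [_ ig]; split; first exact: mh.
apply: (@le_lt_trans _ _ (c%:E * \int[mu]_x (`|g x| `^ beta x)%:E)%E).
  rewrite -ge0_integralZl//; last exact: measurable_modular_integrand.
  apply: ge0_le_integral => //.
  - exact: measurable_modular_integrand.
  - apply: measurable_funeM; exact: measurable_modular_integrand.
  - by move=> x _; rewrite -EFinM lee_fin.
by apply: lte_mul_pinfty.
Qed.

Lemma finite_modular0 : finite_modular (cst 0).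
Proof.
split; first exact: measurable_cst.
rewrite integral0_eq// => x _; rewrite normr0 powR0 ?gt_eqF//.
by case/andP: (beta02 x).
Qed.

(** The constant [(|t| + 1) ^ 2] dominates [|t| ^ b] for all exponents
    [b <= 2]. *)
Lemma finite_modularZ (t : R) g : finite_modular g -> finite_modular (fun x => t * g x).
Proof.
move=> Vg; have [mg _] := Vg.
have t1 : 1 <= `|t| + 1 by rewrite lerDr.
apply: (@finite_modular_le ((`|t| + 1) ^+ 2) g _ _ mg _ _ Vg).
- exact: sqr_ge0.
- exact: measurable_funM.
move=> x; have /andP[b0 b2] := beta02 x.
rewrite normrM powRM// ler_wpM2r ?powR_ge0//.
apply: (@le_trans _ _ ((`|t| + 1) `^ beta x)).
  by apply: ge0_ler_powR; rewrite ?nnegrE ?addr_ge0 ?lerDl// ltW.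
by rewrite -powR_mulrn ?addr_ge0//; apply: ler_powR.
Qed.

(** The sum is at most twice the larger term, and [2 ^ b <= 4]. *)
Lemma powR_normD_le (b x y : R) : 0 < b <= 2 ->
  `|x + y| `^ b <= 4 * (`|x| `^ b + `|y| `^ b).
Proof.
move=> /andP[b0 b2]; wlog xy : x y / `|x| <= `|y|.
  move=> H; have [xy|/ltW yx] := leP `|x| `|y|; first exact: H.
  by have := H _ _ yx; rewrite [y + x]addrC [_ + `|x| `^ b]addrC.
apply: (@le_trans _ _ ((2 * `|y|) `^ b)).
  apply: ge0_ler_powR; rewrite ?nnegrE ?mulr_ge0//; first exact: ltW.
  by rewrite (le_trans (ler_normD _ _))// mulr_natl mulr2n lerD2r.
rewrite powRM// ler_pM ?powR_ge0//; last by rewrite lerDr powR_ge0.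
have -> : 4 = 2 ^+ 2 :> R by rewrite -natrX.
by rewrite -powR_mulrn//; apply: ler_powR => //; rewrite ler1n.
Qed.

Lemma finite_modularD f g : finite_modular f -> finite_modular g ->
  finite_modular (fun x => f x + g x).
Proof.
move=> [mf If] [mg Ig]; split; first exact: measurable_funD.
pose u x := (`|f x| `^ beta x)%:E; pose v x := (`|g x| `^ beta x)%:E.
have mu' : measurable_fun setT u by exact: measurable_modular_integrand.
have mv : measurable_fun setT v by exact: measurable_modular_integrand.
have u0 x : (0 <= u x)%E by rewrite lee_fin powR_ge0.
have v0 x : (0 <= v x)%E by rewrite lee_fin powR_ge0.
apply: (@le_lt_trans _ _ (4%:E * \int[mu]_x (u x + v x))%E).
  rewrite -ge0_integralZl//; last 2 first.
  - exact: emeasurable_funD.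
  - by move=> x _; rewrite adde_ge0.
  apply: ge0_le_integral => //.
  - by apply: measurable_modular_integrand; exact: measurable_funD.
  - by apply: measurable_funeM; exact: emeasurable_funD.
  - by move=> x _; rewrite /u /v -EFinD -EFinM lee_fin powR_normD_le.
by apply: lte_mul_pinfty; [| |rewrite ge0_integralD// lte_add_pinfty].
Qed.

Lemma finite_modular_linear n (f : 'I_n -> R -> R) theta :
  (forall j, finite_modular (f j)) ->
  finite_modular (fun x => \sum_(j < n) theta j * f j x).
Proof.
elim: n f theta => [|n IH] f theta Vf.
  rewrite (_ : (fun _ => _) = cst 0); first exact: finite_modular0.
  by apply/funext => x; rewrite big_ord0.
rewrite (_ : (fun _ => _) = (fun x => theta ord0 * f ord0 x +
   \sum_(j < n) theta (lift ord0 j) * f (lift ord0 j) x)); last first.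
  by apply/funext => x; rewrite big_ord_recl.
by apply: finite_modularD; [exact: finite_modularZ|exact: (IH (fun j => f (lift ord0 j)))].
Qed.

(** A function is cut into a part carried by the points of exponent less than 2,
    to be realized by Poisson processes, and a part carried by those of exponent
    2, where [stable_const] is infinite and white noise takes over. *)
Definition below2 (g : R -> R) (x : R) : R := if beta x < 2 then g x else 0.

Definition at2 (g : R -> R) (x : R) : R := if beta x < 2 then 0 else g x.

Lemma measurable_below2 (g : R -> R) : measurable_fun setT g ->
  measurable_fun setT (below2 g).
Proof.
move=> mg; apply: measurable_fun_ifT => //.
by apply: measurable_fun_ltr => //; exact: measurable_cst.
Qed.

Lemma measurable_at2 (g : R -> R) : measurable_fun setT g -> measurable_fun setT (at2 g).
Proof.
move=> mg; apply: measurable_fun_ifT => //.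
by apply: measurable_fun_ltr => //; exact: measurable_cst.
Qed.

Lemma modular_split (g : R -> R) : measurable_fun setT g ->
  (\int[mu]_x (`|g x| `^ beta x)%:E =
   \int[mu]_x (`|below2 g x| `^ beta x)%:E + \int[mu]_x (at2 g x ^+ 2)%:E)%E.
Proof.
move=> mg; rewrite -ge0_integralD//.
- apply: eq_integral => x _; rewrite /below2 /at2; have /andP[b0 b2] := beta02 x.
  rewrite -EFinD; congr EFin; case: ifPn => b2'; first by rewrite expr0n addr0.
  have -> : beta x = 2 by apply/eqP; rewrite eq_le b2 leNgt.
  by rewrite normr0 powR0// add0r powR_mulrn// real_normK ?num_real.
- by apply: measurable_modular_integrand; exact: measurable_below2.
- by move=> x _; rewrite lee_fin sqr_ge0.
- by apply/measurable_EFinP; apply: measurable_funX; exact: measurable_at2.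
Qed.

End finite_modular.

(** * Realizing the modular *)

Section realizable_modular.
Context d (Om : measurableType d) (R : realType) (P : probability Om R).
Variable cut : Om -> Om * Om.
Hypothesis mcut : measurable_fun setT cut.
Hypothesis Pcut : forall A B, measurable A -> measurable B ->
  P (cut @^-1` (A `*` B)) = (P A * P B)%E.
Variables (X W G : Om -> R) (N : Om -> nat).
Hypothesis mX : measurable_fun setT X.
Hypothesis mW : measurable_fun setT W.
Hypothesis mG : measurable_fun setT G.
Hypothesis mN : measurable_fun setT N.
Hypothesis lawX : forall A, measurable A -> P (X @^-1` A) = normal_prob 0 1 A.
Hypothesis lawW : forall A, measurable A ->
  P (W @^-1` A) = uniform_prob (@ltr01 R) A.
Hypothesis cfG : forall t : R, real_cf P (fun w => t * G w) (expR (- (t ^+ 2 / 2))).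
Hypothesis PN : forall n, P (N @^-1` [set n]) = (poisson_pmf 1 n)%:E.
Variable beta : R -> R.
Hypothesis mbeta : measurable_fun setT beta.
Hypothesis beta02 : forall x, 0 < beta x <= 2.
Local Notation mu := (@lebesgue_measure R).
Local Notation V := (finite_modular beta).

(** The constant in [jump] for which the exponents add up to [|g| ^ beta]: it
    compensates the stable constant and the normal density of the
    sampling point. *)
Definition intensity (x : R) : R :=
  fine (stable_const (beta x)) * normal_pdf 0 1 x.

Definition jump (j : nat) (z : R * R) : R :=
  (intensity z.1 * (j%:R + z.2)) `^ (- (beta z.1)^-1).

Let mbetaV : measurable_fun setT (fun x => (beta x)^-1).
Proof.
have -> : (fun x => (beta x)^-1) = (fun x => beta x `^ (-1)).
  by apply/funext => x; rewrite powR_inv1// ltW//; case/andP: (beta02 x).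
exact: measurableT_comp (measurable_powR _) mbeta.
Qed.

Lemma measurable_intensity : measurable_fun setT intensity.
Proof.
apply: measurable_funM; last exact: measurable_normal_pdf.
apply: measurableT_comp => //.
pose f (z : R * measurableTypeR R) : \bar R :=
  (if 0 < z.2 then 1 - expR (- (z.2 `^ (- (2 / beta z.1)))) else 0)%:E.
have mf : measurable_fun setT f.
  apply/measurable_EFinP; apply: measurable_fun_ifT => //.
  - by apply: measurable_fun_ltr; [exact: measurable_cst|exact: measurable_snd].
  - apply: measurable_funB => //; apply: measurableT_comp => //.
    apply: measurable_funN; apply: measurable_powR2; first exact: measurable_snd.
    apply: measurable_funN; apply: measurable_funM => //.
    exact: measurableT_comp mbetaV (@measurable_fst _ _ R (measurableTypeR R)).
have f0 z : (0 <= f z)%E.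
  rewrite lee_fin; case: ifP => // _.
  by case/andP: (expR_decay01 (powR_ge0 z.2 (- (2 / beta z.1)))).
have -> : (fun x => stable_const (beta x)) = fubini_F mu f.
  apply/funext => x; rewrite /stable_const integral_mkcond.
  apply: eq_integral => w _; rewrite patchE /f /=.
  rewrite (_ : (w \in `]0%R, +oo[%classic) = (0 < w)).
    by case: ifP.
  by apply/idP/idP; rewrite inE /= in_itv /= andbT.
exact: measurable_fun_fubini_tonelli_F.
Qed.

Lemma measurable_jump j : measurable_fun setT (jump j).
Proof.
apply: measurable_powR2.
  apply: measurable_funM.
    exact: measurableT_comp measurable_intensity measurable_fst.
  by apply: measurable_funD => //; exact: measurable_snd.
apply: measurable_funN; exact: measurableT_comp mbetaV measurable_fst.
Qed.

Definition scaled_jump (g : R -> R) j (z : R * R) : R :=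
  below2 beta g z.1 * jump j z.

Lemma measurable_scaled_jump g j : measurable_fun setT g ->
  measurable_fun setT (scaled_jump g j).
Proof.
move=> mg; apply: measurable_funM; last exact: measurable_jump.
exact: measurableT_comp (measurable_below2 mbeta mg) measurable_fst.
Qed.

(** The slices [j] of the jump variable tile the half line, on which
    [integral_stable_scaling] applies. *)
Lemma jump_exponent (g : R -> R) x : measurable_fun setT g ->
  (\sum_(j <oo) (\int[mu]_(w in `[0%R, 1%R])
      (1 - expR (- (scaled_jump g j (x, w) ^+ 2)))%:E * (normal_pdf 0 1 x)%:E) =
   (`|below2 beta g x| `^ beta x)%:E)%E.
Proof.
move=> mg; have /andP[b0 b2] := beta02 x.
have [lt2|ge2] := boolP (beta x < 2); last first.
  rewrite /scaled_jump /below2 /= (negbTE ge2) normr0 powR0 ?gt_eqF//.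
  rewrite eseries0// => j _ _; rewrite integral0_eq ?mul0e// => w _.
  by rewrite mul0r expr0n oppr0 expR0 subrr.
set h := below2 beta g x; set p := normal_pdf 0 1 x.
have p0 : 0 < p.
  by rewrite /p normal_pdfE// mulr_gt0 ?expR_gt0// normal_peak_gt0.
have b02 : 0 < beta x < 2 by rewrite b0.
have k0 := stable_const_gt0 b0; have koo := stable_const_lty b02.
pose k := fine (stable_const (beta x)).
have kE : stable_const (beta x) = k%:E by rewrite fineK// ge0_fin_numE// ltW.
have kp : 0 < k by rewrite -lte_fin -kE.
have c0 : 0 < intensity x by rewrite mulr_gt0.
pose F (v : R) : \bar R :=
  (1 - expR (- (h ^+ 2 * (intensity x * v) `^ (- (2 / beta x)))))%:E.
have FE j w : (1 - expR (- (scaled_jump g j (x, w) ^+ 2)))%:E = F (j%:R + w).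
  rewrite /F /scaled_jump /jump /= exprMn -/h sqr_powR.
  by rewrite mulNr [_^-1 * _]mulrC.
under eq_eseriesr do under eq_integral do rewrite FE.
have mF : measurable_fun setT F.
  apply/measurable_EFinP; apply: measurable_funB => //; apply: measurableT_comp => //.
  apply: measurable_funN; apply: measurable_funM => //.
  apply: measurable_powR2 => //; exact: measurable_funM.
have F0 v : (0 <= F v)%E.
  rewrite lee_fin; have /expR_decay01/andP[//] :
    0 <= h ^+ 2 * (intensity x * v) `^ (- (2 / beta x)).
  by rewrite mulr_ge0 ?sqr_ge0 ?powR_ge0.
transitivity ((p%:E * \sum_(j <oo) \int[mu]_(w in `[0%R, 1%R]) F (j%:R + w)%R)%E).
  rewrite -nneseriesZl; last by move=> j _; exact: integral_ge0.
  by apply: eq_eseriesr => j _; rewrite muleC.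
rewrite nneseries_unit_translates// integral_stable_scaling// kE -!EFinM.
congr EFin; rewrite /intensity -/k -/p; field.
by rewrite !gt_eqF.
Qed.

(** Slice [j] is a compound Poisson process whose jumps are linear in [g]. *)
Lemma realizable_below2 :
  realizable P V (fun g => fine (\int[mu]_x (`|below2 beta g x| `^ beta x)%:E)%E).
Proof.
pose phi j g := mixture_cf P X W (scaled_jump g j).
have VL := finite_modular_linear mbeta beta02.
have phi01 j g : V g -> 0 <= phi j g <= 1.
  move=> [mg _]; apply: (mixture_cf01 mcut Pcut mX mW mG cfG).
  exact: measurable_scaled_jump.
apply: (@realizable_sum _ _ _ P cut mcut Pcut V (fun j g => 1 - phi j g)) => //.
- move=> j; apply: (@realizable_poisson _ _ _ P cut mcut Pcut N mN PN V
    (fun g => gauss_mixture cut X W G (scaled_jump g j))) => //.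
  + move=> f [mf _]; apply: (measurable_gauss_mixture mcut mX mW mG).
    exact: measurable_scaled_jump.
  + move=> n f theta w; rewrite /gauss_mixture /scaled_jump /below2.
    set x := X _; case: ifP => _; last first.
      by rewrite big1 => [|i _]; rewrite !(mul0r, mulr0).
    rewrite mulr_suml mulr_sumr mulr_suml; apply: eq_bigr => i _; ring.
  + by move=> g Vg; exact: phi01.
  + move=> f [mf _]; apply: (real_cf_gauss_mixture mcut Pcut mX mW mG cfG).
    exact: measurable_scaled_jump.
- by move=> j g Vg; rewrite subr_ge0; case/andP: (phi01 j g Vg).
move=> g Vg; have [mg ig] := Vg; apply: series_cvg_fine.
- by move=> j; rewrite subr_ge0; case/andP: (phi01 j g Vg).
- transitivity (\sum_(j <oo) \int[mu]_x ((\int[mu]_(w in `[0%R, 1%R])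
      (1 - expR (- (scaled_jump g j (x, w) ^+ 2)))%:E) *
     (normal_pdf 0 1 x)%:E))%E.
    apply: eq_eseriesr => j _.
    exact: (mixture_exponent mX mW lawX lawW (measurable_scaled_jump j mg)).
  rewrite -integral_nneseries//.
  + by apply: eq_integral => x _; exact: jump_exponent.
  + move=> j; apply: emeasurable_funM; last first.
      by apply/measurable_EFinP; exact: measurable_normal_pdf.
    have mS := measurable_scaled_jump j mg.
    apply: (@measurable_unit_integral R
      (fun z => 1 - expR (- (scaled_jump g j z ^+ 2)))) => [|z].
      apply: measurable_funB => //; apply: measurableT_comp => //.
      by apply: measurable_funN; exact: measurable_funX.
    by case/andP: (expR_decay01 (sqr_ge0 (scaled_jump g j z))).
  + move=> j x _; rewrite mule_ge0 ?lee_fin ?normal_pdf_ge0//.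
    apply: integral_ge0 => w _; rewrite lee_fin.
    by case/andP: (expR_decay01 (sqr_ge0 (scaled_jump g j (x, w)))).
apply: le_lt_trans ig; rewrite (modular_split mbeta beta02 mg).
by rewrite leeDl// integral_ge0// => x _; rewrite lee_fin sqr_ge0.
Qed.

Lemma realizable_precomp (U V' : set (R -> R)) (psi : (R -> R) -> R)
    (l : (R -> R) -> R -> R) :
  (forall f, U f -> V' (l f)) ->
  (forall n (f : 'I_n -> R -> R) theta,
    l (fun x => \sum_(j < n) theta j * f j x) =
    (fun x => \sum_(j < n) theta j * l (f j) x)) ->
  realizable P V' psi -> realizable P U (psi \o l).
Proof.
move=> Vl ll [I mI cI]; exists (I \o l) => [f Uf|n f theta Uf]; first exact/mI/Vl.
rewrite /= ll; apply: (cI n (fun j => l (f j))) => j; exact/Vl/Uf.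
Qed.

Lemma realizable0 (U : set (R -> R)) : realizable P U (fun=> 0).
Proof.
exists (fun=> cst 0) => [f _|n f theta _]; first exact: measurable_cst.
rewrite oppr0 expR0 (_ : (fun _ => _) = cst 0); first exact: real_cf0.
by apply/funext => w; rewrite big1// => j _; rewrite mulr0.
Qed.

(** The modular is the sum of the Poisson and the Gaussian parts. *)
Lemma realizable_modular :
  realizable P V (fun g => fine (\int[mu]_x (`|g x| `^ beta x)%:E)%E).
Proof.
pose psi1 g := fine (\int[mu]_x (`|below2 beta g x| `^ beta x)%:E)%E.
pose psi2 g := fine (\int[mu]_x (at2 beta g x ^+ 2)%:E)%E.
have VL := finite_modular_linear mbeta beta02.
have pos1 g : (0 <= \int[mu]_x (`|below2 beta g x| `^ beta x)%:E)%E.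
  by apply: integral_ge0 => x _; rewrite lee_fin powR_ge0.
have pos2 g : (0 <= \int[mu]_x (at2 beta g x ^+ 2)%:E)%E.
  by apply: integral_ge0 => x _; rewrite lee_fin sqr_ge0.
have fin1 g : V g -> (\int[mu]_x (`|below2 beta g x| `^ beta x)%:E < +oo)%E.
  by move=> [mg]; apply: le_lt_trans; rewrite (modular_split mbeta beta02 mg) leeDl.
have fin2 g : V g -> (\int[mu]_x (at2 beta g x ^+ 2)%:E < +oo)%E.
  by move=> [mg]; apply: le_lt_trans; rewrite (modular_split mbeta beta02 mg) leeDr.
apply: (@realizable_sum _ _ _ P cut mcut Pcut V
  (fun k => match k with 0%N => psi1 | 1%N => psi2 | _ => fun=> 0 end)) => //.
- case=> [|[|k]]; [exact: realizable_below2| |exact: realizable0].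
  have := realizable_white_noise mcut Pcut mG cfG.
  apply: realizable_precomp => [g Vg|n f theta].
    by split; [apply: measurable_at2 => //; case: Vg|exact: fin2].
  apply/funext => x; rewrite /at2; case: ifP => // _.
  by rewrite big1// => j _; rewrite mulr0.
- by case=> [|[|k]] g Vg //; rewrite fine_ge0.
move=> g Vg; have [mg _] := Vg.
apply: cvg_near_cst; exists 2%N => //= -[|[|n]]//= _.
rewrite /series /= big_mkord !big_ord_recl big1//= addr0.
rewrite (modular_split mbeta beta02 mg) fineD// ge0_fin_numE//.
  exact: fin1.
exact: fin2.
Qed.

End realizable_modular.

(** * Building blocks on the space of coins *)

Section fair_laws.
Variable R : realType.

Lemma real_cf_law d (T : measurableType d) (P : probability T R) (X : T -> R)
    (nu : probability (measurableTypeR R) R) (t c : R) :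
  measurable_fun setT X -> (forall A, measurable A -> P (X @^-1` A) = nu A) ->
  real_cf nu ( *%R t) c -> real_cf P (fun w => t * X w) c.
Proof.
move=> mX law [nc ns].
have mX' : measurable_fun setT (X : T -> measurableTypeR R) by [].
pose Q : {measure set (measurableTypeR R) -> \bar R} :=
  measure_function_pushforward__canonical__measure_function_Measure P mX'.
have E (f : R -> R) : measurable_fun setT f -> (forall x, `|f x| <= 1) ->
    \int[P]_w f (X w) = \int[nu]_x f x.
  move=> mf f1; rewrite /Rintegral; congr fine.
  transitivity (\int[Q]_x (f x)%:E)%E; last first.
    by apply: eq_measure_integral => A mA _; exact: law.
  rewrite [RHS]integral_pushforward//; first exact/measurable_EFinP.
  by apply: (@bounded_integrable _ _ _ P 1) => //; exact: measurableT_comp.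
have mt : measurable_fun setT ( *%R t : R -> R) by exact: mulrl_measurable.
split.
- rewrite -nc; apply: (E (cos \o *%R t)) => [|x]; last exact: cos_max.
  exact: measurableT_comp (@measurable_cos R) mt.
- rewrite -ns; apply: (E (sin \o *%R t)) => [|x]; last exact: sin_max.
  exact: measurableT_comp (@measurable_sin R) mt.
Qed.

Lemma fair_law (nu : probability (measurableTypeR R) R) :
  exists2 Y : coins -> R, measurable_fun setT Y &
    forall A, measurable A -> fair R (Y @^-1` A) = nu A.
Proof.
have mid : measurable_fun setT (id : measurableTypeR R -> R) by [].
exact: (fair_sample (mfun_of mid : {RV nu >-> R})).
Qed.

(** The sampled variable is real; its truncation is integer valued and
    has the same law, as the law is carried by the integers. *)
Lemma fair_poisson : exists2 N : coins -> nat, measurable_fun setT N &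
  forall n, fair R (N @^-1` [set n]) = (poisson_pmf 1 n)%:E.
Proof.
have mnat : measurable_fun setT (fun n : nat => n%:R : R) by [].
have [Y mY lawY] :=
  fair_sample (mfun_of mnat : {RV (@poisson_prob R 1 0) >-> R}).
exists (fun w => Num.truncn (Y w)).
  exact: measurableT_comp (@measurable_truncn R) mY.
move=> n; rewrite (_ : _ @^-1` _ = Y @^-1` (Num.truncn @^-1` [set n]))//.
rewrite lawY; last first.
  by rewrite -[X in measurable X]setTI; exact: measurable_truncn.
rewrite (_ : _ @^-1` _ = [set n]).
  rewrite /= /poisson_prob ltr01.
  by apply: (@esum_set1 R nat n (fun k => (poisson_pmf 1 k)%:E)); rewrite lee_fin poisson_pmf_ge0.
by apply/seteqP; split => k /=; rewrite natrK.
Qed.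

(** The same sampled variable can serve as [X] and as [G], since each of them is
    evaluated at its own independent part of the coins. *)
Lemma fair_realizable_modular (beta : R -> R) : measurable_fun setT beta ->
  (forall x, 0 < beta x <= 2) ->
  realizable (fair R) (finite_modular beta)
    (fun g => fine (\int[@lebesgue_measure R]_x (`|g x| `^ beta x)%:E)%E).
Proof.
move=> mbeta beta02.
have [X mX lawX] := fair_law (normal_prob 0 1).
have [W mW lawW] := fair_law (uniform_prob (@ltr01 R)).
have [N mN PN] := fair_poisson.
apply: (@realizable_modular _ coins R (fair R) unzip measurable_unzip _
  X W X N mX mW mX mN lawX lawW _ PN beta mbeta beta02).
- exact: fair_unzip.
- move=> t; apply: (real_cf_law mX lawX); exact: normal_cf.
Qed.

End fair_laws.

(** * Lebesgue measurable functions *)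

Section borel_versions.
Variable R : realType.
Local Notation mu := (@lebesgue_measure R).
Local Notation cmu := (@completed_lebesgue_measure R).

Lemma borel_mod_null (E : set (lebesgueR R)) : measurable E ->
  exists A Z : set R, [/\ measurable A, measurable Z, mu Z = 0%E &
    forall x, ~ Z x -> E x <-> A x].
Proof.
rewrite -[X in X E]completed_caratheodory_measurable g_sigma_completed_algebra_genE.
move=> [A mA [N [Z [mZ Z0 NZ]]] <-]; exists A, Z; split => // x nZx.
by split => [[//|/NZ]|]; [|left].
Qed.

(** Discard a Borel null set outside of which the sets [q < f], for rational
    [q], are Borel. *)
Lemma borel_version (f : lebesgueR R -> R) : measurable_fun setT f ->
  exists2 g : R -> R, measurable_fun setT g & {ae cmu, forall x, f x = g x}.
Proof.
(* An enumeration of the rationals, with 0 at the unused codes. *)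
move=> mf; pose q n : R := ratr (odflt 0%Q (unpickle n)).
have /choice[AZ AZP] n : exists AZ : set R * set R,
    [/\ measurable AZ.1, measurable AZ.2, mu AZ.2 = 0%E &
        forall x, ~ AZ.2 x -> q n < f x <-> AZ.1 x].
  have mE : measurable (f @^-1` `]q n, +oo[).
    by rewrite -[X in measurable X]setTI; exact: mf.
  have [A [Z [mA mZ Z0 EA]]] := borel_mod_null mE.
  exists (A, Z); split => //= x /EA; rewrite /= in_itv /= andbT; exact.
pose Z := \bigcup_n (AZ n).2.
have mZ : measurable Z by apply: bigcupT_measurable => n; case: (AZP n).
have Z0 : mu Z = 0%E.
  apply: measure_negligible => //; apply: negligible_bigcup => n.
  by have [_ mZn Zn0 _] := AZP n; exists (AZ n).2; split.
pose g x := if x \in Z then 0 else f x.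
exists g.
  apply: (@measurability _ _ _ _ _ _ (@RGenOInfty.G R)).
    exact: RGenOInfty.measurableE.
  move=> _ [_ [t ->] <-]; rewrite setTI.
  rewrite (_ : _ @^-1` _ = (Z `&` [set _ | t < 0]) `|`
     (~` Z `&` \bigcup_n ((AZ n).1 `&` [set _ | t <= q n]))).
    have mc (b : bool) : measurable [set _ : R | b].
      have [->|->] : [set _ : R | b] = setT \/ [set _ : R | b] = set0.
      - by case: b; [left|right]; apply/seteqP; split.
      - exact: measurableT.
      - exact: measurable0.
    apply: measurableU; first exact: measurableI.
    apply: measurableI; first exact: measurableC.
    apply: bigcupT_measurable => n; apply: measurableI => //.
    by case: (AZP n).
  apply/seteqP; split => x /=; rewrite /g in_itv /= andbT.
    case: ifPn => [|nZ tf]; first by rewrite inE; left.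
    right; have {}nZ : ~ Z x by move/negP: nZ; rewrite inE.
    split => //; have [r] := rat_in_itvoo tf; rewrite in_itv /= => /andP[tr rf].
    have qr : q (pickle r) = ratr r by rewrite /q pickleK.
    exists (pickle r) => //; split; last by rewrite /= qr ltW.
    have [_ _ _ H] := AZP (pickle r); apply/H; last by rewrite qr.
    by move=> Zx; apply: nZ; exists (pickle r).
  case=> [[Zx t0]|[nZ [n _ [Ax tq]]]]; first by rewrite mem_set.
  rewrite memNset//; apply: (le_lt_trans tq).
  have [_ _ _ H] := AZP n; apply/H => // Zx.
  by apply: nZ; exists n.
exists Z; split.
- exact: sub_caratheodory.
- exact: Z0.
- by move=> x /= fg; apply: contrapT => nZ; apply: fg; rewrite /g memNset.
Qed.

(** The identity carries the completed measure to Lebesgue measure on the Borel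
    sets. *)
Lemma ge0_integral_completed (h : R -> \bar R) : measurable_fun setT h ->
  (forall x, 0 <= h x)%E -> (\int[cmu]_x h x = \int[mu]_x h x)%E.
Proof.
move=> mh h0.
have mid : measurable_fun setT (id : lebesgueR R -> measurableTypeR R).
  by move=> _ A mA; rewrite setTI; exact: sub_caratheodory.
pose Q : {measure set (measurableTypeR R) -> \bar R} :=
  measure_function_pushforward__canonical__measure_function_Measure cmu mid.
transitivity (\int[Q]_x h x)%E; first by rewrite [RHS]ge0_integral_pushforward.
by apply: eq_measure_integral => A mA _.
Qed.

Lemma modular_borel (alpha f : lebesgueR R -> R) (beta g : R -> R) :
  measurable_fun setT alpha -> measurable_fun setT f ->
  measurable_fun setT beta -> measurable_fun setT g ->
  {ae cmu, forall x, alpha x = beta x} -> {ae cmu, forall x, f x = g x} ->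
  modular alpha f = (\int[mu]_x (`|g x| `^ beta x)%:E)%E.
Proof.
move=> malpha mf mbeta mg ab fg.
have mid : measurable_fun setT (id : lebesgueR R -> R).
  by move=> _ A mA; rewrite setTI; exact: sub_caratheodory.
pose h (x : R) : \bar R := (`|g x| `^ beta x)%:E.
have mh : measurable_fun setT h by exact: measurable_modular_integrand.
have h0 x : (0 <= h x)%E by rewrite lee_fin powR_ge0.
apply: etrans (ge0_integral_completed mh h0).
pose k (x : lebesgueR R) : \bar R := (`|f x| `^ alpha x)%:E.
have mk : measurable_fun setT k.
  apply/measurable_EFinP.
  exact: (measurable_powR2 (measurableT_comp (@normr_measurable R setT) mf) malpha).
have mhc : measurable_fun setT (h : lebesgueR R -> \bar R).
  exact: (measurableT_comp mh mid).
have k0 x : (0 <= k x)%E by rewrite lee_fin powR_ge0.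
apply: (@ge0_ae_eq_integral _ _ _ cmu setT k h measurableT mk mhc) => //.
by move: ab fg; apply: filterS2 => x abx fgx _; rewrite /k /h abx fgx.
Qed.

End borel_versions.

(** Unless [f] vanishes almost everywhere, a finite norm provides some [l] for
    which the modular of [f / l] is 1, and finiteness of the modular does not
    depend on the scale. *)
Lemma finite_modular_of_Fspace (R : realType) (alpha f : lebesgueR R -> R)
    (beta g : R -> R) :
  measurable_fun setT alpha -> measurable_fun setT beta ->
  (forall x, 0 < beta x <= 2) ->
  {ae @completed_lebesgue_measure R, forall x, alpha x = beta x} ->
  Fspace alpha f -> measurable_fun setT g ->
  {ae @completed_lebesgue_measure R, forall x, f x = g x} ->
  finite_modular beta g.
Proof.
move=> malpha mbeta beta02 ab [mf foo] mg fg.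
move: foo; rewrite /vnorm; case: ifPn => [/asboolP f0 _|_ foo].
  split=> //; rewrite -(modular_borel malpha mf mbeta mg ab fg).
  have mid : measurable_fun setT (id : lebesgueR R -> R).
    by move=> _ A mA; rewrite setTI; exact: sub_caratheodory.
  have m0 : measurable_fun setT (cst 0 : R -> R) by exact: measurable_cst.
  rewrite (modular_borel malpha mf mbeta m0 ab f0).
  by have [_] := finite_modular0 beta02.
(* The infimum of the empty set would be infinite. *)
have [l [l0 fl1]] : exists l : R, 0 < l /\ modular alpha (fun x => f x / l) = 1%E.
  apply: contrapT => H; move: foo; rewrite (_ : [set l | _] = set0).
    by rewrite image_set0 ereal_inf0 ltxx.
  by apply/seteqP; split => // l ?; apply: H; exists l.
have mfl : measurable_fun setT (fun x => f x / l).
  exact: (measurableT_comp (mulrr_measurable l^-1) mf).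
have mgl : measurable_fun setT (fun x => g x / l).
  exact: (measurableT_comp (mulrr_measurable l^-1) mg).
have gl : finite_modular beta (fun x => g x / l).
  split=> //; rewrite -(modular_borel malpha mfl mbeta mgl ab) ?fl1 ?ltry//.
  by move: fg; apply: filterS => x ->.
have := finite_modularZ mbeta beta02 l gl.
rewrite (_ : (fun _ => _) = g)//; apply/funext => x.
by rewrite mulrC divfK ?gt_eqF.
Qed.

Lemma cexpectation_real_cf d (Om : measurableType d) (R : realType)
    (P : probability Om R) (X : Om -> R) (c : R) : real_cf P X c ->
  cexpectation P (fun w => cexp ('i%C * (X w)%:C%C)) = c%:C%C.
Proof.
move=> [Xc X0]; rewrite /cexpectation.
have reE (x : R) : complex.Re (cexp ('i%C * x%:C%C)) = cos x.
  by rewrite /cexp /= !mul0r mulr0 subr0 add0r expR0 !mul1r.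
have imE (x : R) : complex.Im (cexp ('i%C * x%:C%C)) = sin x.
  by rewrite /cexp /= !mul0r mulr0 subr0 add0r expR0 !mul1r.
have -> : (fun w => complex.Re (cexp ('i%C * (X w)%:C%C))) = (fun w => cos (X w)).
  by apply/funext => w; exact: reE.
have -> : (fun w => complex.Im (cexp ('i%C * (X w)%:C%C))) = (fun w => sin (X w)).
  by apply/funext => w; exact: imE.
have E (Y : Om -> R) : fine 'E_P[Y] = \int[P]_w Y w by rewrite unlock.
by rewrite !E Xc X0.
Qed.

Theorem theorem2p2 (R : realType) (a : R) (alpha : lebesgueR R -> R)
    (a_gt0 : 0 < a) (a_le2 : a <= 2)
    (malpha : measurable_fun setT alpha)
    (alpha_bnd : forall x, a <= alpha x <= 2) :
  exists (disp : measure_display) (Omega : measurableType disp)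
         (P : probability Omega R)
         (I : set_type (Fspace alpha) -> {RV P >-> R}),
    forall (d : nat) (f : 'I_d -> set_type (Fspace alpha)) (theta : 'I_d -> R),
      cexpectation P
        (fun w => cexp ('i%C * (\sum_(j < d) theta j * I (f j) w)%:C%C))
      = (fine (expeR (- \int[@completed_lebesgue_measure R]_x
           (`|\sum_(j < d) theta j * val (f j) x| `^ alpha x)%:E)%E))%:C%C.
Proof.
have [beta0 mbeta0 ab0] := borel_version malpha.
(* The Borel version may leave the range of [alpha] on a null set. *)
pose beta x := Num.min 2 (Num.max a (beta0 x)).
have mbeta : measurable_fun setT beta.
  by apply: measurable_minr => //; apply: measurable_maxr.
have beta02 x : 0 < beta x <= 2.
  by rewrite /beta lt_min ltr0n lt_max a_gt0 ge_min lexx.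
have ab : {ae @completed_lebesgue_measure R, forall x, alpha x = beta x}.
  move: ab0; apply: filterS => x abx; rewrite /beta -abx.
  by have /andP[a1 a2] := alpha_bnd x; rewrite max_r// min_r.
have /choice[g gP] : forall f : set_type (Fspace alpha), exists g : R -> R,
    finite_modular beta g /\
    {ae @completed_lebesgue_measure R, forall x, val f x = g x}.
  move=> f; have Ff := set_valP f; have [mf _] := Ff.
  have [g mg fg] := borel_version mf; exists g; split => //.
  exact: (finite_modular_of_Fspace malpha mbeta beta02 ab Ff mg fg).
have [J mJ cfJ] := fair_realizable_modular mbeta beta02.
exists _, coins, (fair R), (fun f => mfun_of (mJ _ (gP f).1)).
move=> d f theta; apply: (etrans (cexpectation_real_cf _)).
  apply: (cfJ d (fun j => g (f j)) theta) => j; exact: (gP (f j)).1.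
congr (_%:C%C).
have VL := finite_modular_linear mbeta beta02 theta (fun j => (gP (f j)).1).
set s := (fun x : R => \sum_(j < d) theta j * g (f j) x) in VL *.
have E : modular alpha (fun x => \sum_(j < d) theta j * val (f j) x) =
    (\int[@lebesgue_measure R]_x (`|s x| `^ beta x)%:E)%E.
  apply: (modular_borel malpha _ mbeta _ ab).
  - have mj j : measurable_fun setT (fun x => theta j * val (f j) x).
      have [mf _] := set_valP (f j).
      exact: (measurableT_comp (mulrl_measurable (theta j)) mf).
    exact: (measurable_sum (index_enum 'I_d) mj).
  - by case: VL.
  - have : {ae @completed_lebesgue_measure R,
        forall x, forall j, val (f j) x = g (f j) x}.
      by apply: filter_forall => j; exact: (gP (f j)).2.
    by apply: filterS => x H; apply: eq_bigr => j _; rewrite H.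
have [_ fin] := VL.
have pos : (0 <= \int[@lebesgue_measure R]_x (`|s x| `^ beta x)%:E)%E.
  by apply: integral_ge0 => x _; rewrite lee_fin powR_ge0.
move: E; rewrite /modular => ->.
have fA : (\int[@lebesgue_measure R]_x (`|s x| `^ beta x)%:E)%E \is a fin_num.
  by rewrite ge0_fin_numE.
by rewrite -[X in expeR (- X)](fineK fA).
Qed.
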